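(* Let $G$ be a locally compact, $\sigma$-compact abelian group and let $\mathcal N=(N,\Omega,m,T)$ be a full spatial process over $G$ such that $N(\varphi)\in L^\infty(\Omega,m)$ for all $\varphi\in C_c(G)$. Then $\mathcal N$ is equivalent to (the spatial process of) a translation bounded measure dynamical system (TBMDS).
   Context: Notation: $G$ is written additively. $C_c(G)$ is the space of continuous compactly supported functions $G\to\mathbb C$, with the locally convex inductive limit topology of the spaces $C_c(K)$ (continuous functions on $G$ with support in the compact set $K\subset G$, sup norm). $\tau_t\varphi=\varphi(\cdot-t)$ for $t\in G$. Dynamical systems: a dynamical system $(X,\alpha)$ over $G$ is either topological ($X$ compact Hausdorff and $\alpha:G\times X\to X$ a continuous action) or measurable ($X$ a measurable space and $\alpha$ an action of $G$ on $X$ that is measurable in each variable). If $m$ is a $G$-invariant probability measure on $X$, the Koopman representation $T$ of $G$ on $L^2(X,m)$ is $T_tf=f\circ\alpha_{-t}$. Spatial process: $\mathcal N=(N,X,m,T)$ consists of a dynamical system $(X,\alpha)$ over $G$, a $G$-invariant probability measure $m$ on $X$, with Koopman representation $T$, and a linear continuous map $N:C_c(G)\to L^2(X,m)$ with $\overline{N(\varphi)}=N(\overline\varphi)$ for all $\varphi\in C_c(G)$ and $T_t\circ N=N\circ\tau_t$ for all $t\in G$. It is full if the linear span of all products $\vartheta_1(N(\varphi_1))\cdots\vartheta_n(N(\varphi_n))$, $n\in\mathbb N$, $\vartheta_j\in C_c(\mathbb C)$, $\varphi_j\in C_c(G)$, is dense in $L^2(X,m)$. Equivalence: spatial processes $(N,X,m,T)$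 and $(N',X',m',T')$ are equivalent (spatially isomorphic) if there is a unitary $U:L^2(X,m)\to L^2(X',m')$ with $U\circ N=N'$, $U\circ T_t=T'_t\circ U$ for all $t\in G$, $U(fg)=U(f)U(g)$ for all $f,g\in L^\infty(X,m)$ and $U^{-1}(f'g')=U^{-1}(f')U^{-1}(g')$ for all $f',g'\in L^\infty(X',m')$. Such a $U$ is called a spatial isomorphism. TBMDS: $\mathcal M(G)$ is the dual of $C_c(G)$ (complex measures on $G$ in the sense of Riesz–Markov), with the vague (weak-$*$) topology, and $G$ acts on it by $\alpha_t(\nu)(\varphi)=\nu(\tau_{-t}\varphi)$. A measure $\nu\in\mathcal M(G)$ is translation bounded if $t\mapsto\nu(\tau_t\varphi)$ is bounded on $G$ for every $\varphi\in C_c(G)$; $\mathcal M^\infty(G)$ is the set of these. A TBMDS is $(\Omega',\alpha)$ with $\Omega'\subset\mathcal M^\infty(G)$ vaguely compact and $\alpha$-invariant; together with an $\alpha$-invariant probability measure $m'$ on $\Omega'$ it yields the spatial process $(N',\Omega',m',T')$ where $N'(\varphi)(\omega)=\omega(\varphi)=\int_G\varphi\,d\omega$ and $T'$ is the Koopman representation. *)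

(* Defs.v *)
From HB Require Import structures.
From mathcomp Require Import all_boot all_order all_algebra.
From mathcomp Require Import all_classical all_reals all_analysis.
From mathcomp Require Import measurable_realfun.
From mathcomp Require Import complex.
Set Implicit Arguments.
Unset Strict Implicit.
Unset Printing Implicit Defensive.
Import Order.TTheory GRing.Theory Num.Theory.
Import numFieldNormedType.Exports.
Local Open Scope classical_set_scope.
Local Open Scope ring_scope.
Local Open Scope complex_scope.

(* The complex numbers over R, as a normed module over themselves. *)
Notation "R [i]^o" := (GRing.regular (complex R))
  (at level 1, format "R [i]^o") : type_scope.

Definition sigma_compact (X : topologicalType) (A : set X) :=
  exists2 K : nat -> set X, (forall n, compact (K n)) & \bigcup_n K n = A.

Section Cc.
Context (R : realType) (X : topologicalType).

Definition tsupport (f : X -> R[i]^o) : set X := closure [set x | f x != 0].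

Definition Cc_pred : {pred X -> R[i]^o} :=
  mem [set f : X -> R[i]^o | continuous f /\ compact (tsupport f)].

Lemma tsupportD (a : R[i]) (f g : X -> R[i]^o) :
  tsupport (a *: f + g) `<=` tsupport f `|` tsupport g.
Proof.
rewrite /tsupport -closureU; apply: closure_subset => x /= /eqP fg.
have [f0|?] := eqVneq (f x) 0; last by left.
by right; apply/eqP => g0; apply: fg; rewrite !fctE f0 g0 scaler0 addr0.
Qed.

Lemma tsupport_closed (f : X -> R[i]^o) : closed (tsupport f).
Proof. exact: closed_closure. Qed.

Lemma tsupport0 : tsupport 0 = set0.
Proof.
rewrite /tsupport (_ : [set _ | _] = set0) ?closure0//.
by apply/seteqP; split => x //=; rewrite eqxx.
Qed.

Fact Cc_submod_closed : submod_closed Cc_pred.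
Proof.
split => [|a f g].
  by rewrite inE /= tsupport0; split; [exact: cst_continuous|exact: compact0].
rewrite !inE /= => -[cf kf] [cg kg]; split.
  move=> x; apply: (@continuousD _ R[i]^o); last exact: cg.
  by apply: (@continuousZr _ R[i]^o) => //; exact: cf.
apply: (subclosed_compact (@tsupport_closed _) (compactU kf kg)).
exact: tsupportD.
Qed.

HB.instance Definition _ :=
  GRing.isSubmodClosed.Build R[i] (X -> R[i]^o) Cc_pred Cc_submod_closed.

Record Cc := MkCc { Cc_fun :> X -> R[i]^o; Cc_funP : Cc_fun \in Cc_pred }.

HB.instance Definition _ := [isSub for Cc_fun].
HB.instance Definition _ := [Choice of Cc by <:].
HB.instance Definition _ := [SubChoice_isSubLmodule of Cc by <:].

End Cc.

Section Cc_topology.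
Context (R : realType) (X : topologicalType).
Local Notation Cc := (Cc R X).

Lemma CcP (f : Cc) : continuous f /\ compact (tsupport f).
Proof. by have := Cc_funP f; rewrite inE. Qed.

Lemma Cc_ext (f g : Cc) : f =1 g -> f = g.
Proof. by move=> fg; apply: val_inj; apply/funext. Qed.

Definition CcK (K : set X) : set Cc := [set f | tsupport f `<=` K].

Definition absolutely_convex (V : lmodType R[i]) (W : set V) :=
  forall (u v : V) (a b : R[i]),
    W u -> W v -> `|a| + `|b| <= 1 -> W (a *: u + b *: v).

(* The base of neighbourhoods of 0 of the finest locally convex topology for
   which all the inclusions of the spaces CcK K, K compact, with the sup norm,
   are continuous. *)
Definition Cc_nbhs0 (W : set Cc) :=
  absolutely_convex W /\
  forall K : set X, compact K -> exists2 e : R, 0 < e &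
    forall f : Cc, CcK K f -> (forall x, `|f x| <= e%:C) -> W f.

Definition Cc_nbhs (f : Cc) : set_system Cc :=
  [set V | exists2 W, Cc_nbhs0 W & forall g, W (g - f) -> V g].

Lemma Cc_nbhs00 W : Cc_nbhs0 W -> W 0.
Proof.
move=> [_ /(_ set0 (@compact0 X))[e e0]]; apply.
  by rewrite /CcK /= tsupport0.
by move=> x; rewrite normr0 ler0c ltW.
Qed.

Fact Cc_nbhs_filter f : ProperFilter (Cc_nbhs f).
Proof.
apply: Build_ProperFilter_ex => [V [W W0 WV]|].
  by exists f; apply: WV; rewrite subrr; exact: Cc_nbhs00.
split.
- exists setT => //; split=> // K _; exists 1 => //.
- move=> P Q [V [aV kV] VP] [W [aW kW] WQ]; exists (V `&` W).
    split=> [u v a b [Vu Wu] [Vv Wv] ab|K cK].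
      by split; [exact: aV|exact: aW].
    have [d d0 dV] := kV _ cK; have [e e0 eW] := kW _ cK.
    exists (Num.min d e); first by rewrite lt_min d0.
    move=> g gK ge; split; [apply: dV|apply: eW] => // x;
      by rewrite (le_trans (ge x))// lecR ge_min lexx ?orbT.
  by move=> g [Vg Wg]; split; [exact: VP|exact: WQ].
- by move=> P Q PQ [W W0 WP]; exists W => // g /WP /PQ.
Qed.

Fact Cc_nbhs_singleton f V : Cc_nbhs f V -> V f.
Proof. by move=> [W W0]; apply; rewrite subrr; exact: Cc_nbhs00. Qed.

Fact Cc_nbhs_nbhs f V : Cc_nbhs f V -> Cc_nbhs f (Cc_nbhs^~ V).
Proof.
move=> [W [aW kW] WV].
have W'0 : Cc_nbhs0 [set g | W (2 *: g)].
  split=> [u v a b Wu Wv ab /=|K cK].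
    by rewrite scalerDr !scalerA ![2 * _]mulrC -!scalerA; exact: aW.
  have [e e0 eW] := kW _ cK; exists (e / 2); first by rewrite divr_gt0.
  move=> g gK ge; apply: eW => [|x].
    apply: subset_trans gK; apply: closure_subset => x /=.
    by apply: contra_neq => g0; rewrite -[LHS]/(2 *: (g x)) g0 scaler0.
  rewrite -[X in `|X|]/(2 *: (g x)) normrZ normr_nat.
  rewrite (le_trans (ler_wpM2l _ (ge x)))//.
  by rewrite rmorphM /= fmorphV rmorph_nat mulrC divfK// pnatr_eq0.
exists [set g | W (2 *: g)] => // g /= Wgf.
exists [set g | W (2 *: g)] => // h /= Whg; apply: WV.
have -> : h - f = 2^-1 *: (2 *: (h - g)) + 2^-1 *: (2 *: (g - f)).
  by rewrite !scalerA mulVf ?pnatr_eq0// !scale1r addrA subrK.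
apply: aW => //; rewrite ger0_norm ?invr_ge0 ?ler0n//.
by rewrite -mulr2n -[X in X <= _]mulr_natr mulVf ?pnatr_eq0.
Qed.

HB.instance Definition _ := hasNbhs.Build Cc Cc_nbhs.
HB.instance Definition _ := Nbhs_isNbhsTopological.Build Cc
  Cc_nbhs_filter Cc_nbhs_singleton Cc_nbhs_nbhs.

Lemma conj_continuous : continuous (fun z : R[i]^o => z^* : R[i]^o).
Proof.
move=> z V [e e0 eV]; exists e => // w zw; apply: eV.
by rewrite /ball_ /= -rmorphB /= normcJ.
Qed.

Fact Cc_conj_subproof (f : Cc) : (fun x => (f x)^* : R[i]^o) \in @Cc_pred R X.
Proof.
have [cf kf] := CcP f; rewrite inE; split.
  by move=> x; apply: continuous_comp; [exact: cf|exact: conj_continuous].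
by apply: (subclosed_compact (@tsupport_closed _ _ _) kf);
  apply: closure_subset => x /=; rewrite conjc_eq0.
Qed.

Definition Cc_conj (f : Cc) : Cc := MkCc (Cc_conj_subproof f).

End Cc_topology.

Section translation.
Context (R : realType) (G : topologicalZmodType).
Local Notation Cc := (Cc R G).

Lemma subr_continuous (t : G) : continuous (fun x : G => x - t).
Proof.
move=> x; apply: (@continuous_comp _ _ _ (fun x : G => (x, - t))
  (fun p : G * G => p.1 + p.2)); last exact: add_continuous.
by apply: cvg_pair; [exact: cvg_id|exact: cvg_cst].
Qed.

Lemma tsupport_translate (t : G) (f : G -> R[i]^o) :
  tsupport (fun x => f (x - t)) `<=` (fun x => x + t) @` tsupport f.
Proof.
move=> x fx; exists (x - t); last by rewrite subrK.
move=> B /(subr_continuous (x := x))/fx[y /= [fy By]].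
by exists (y - t).
Qed.

Fact translate_subproof (t : G) (f : Cc) :
  (fun x => f (x - t)) \in @Cc_pred R G.
Proof.
have [cf kf] := CcP f; rewrite inE; split.
  move=> x; apply: (@continuous_comp _ _ _ (fun x : G => x - t) f).
    exact: subr_continuous.
  exact: cf.
apply: (subclosed_compact _ _ (@tsupport_translate t f)).
  exact: tsupport_closed.
apply: continuous_compact => //; apply/continuous_subspaceT => x.
by have /= := @subr_continuous (- t) x; rewrite opprK.
Qed.

Definition translate (t : G) (f : Cc) : Cc := MkCc (translate_subproof t f).

Fact translate_is_linear t : linear (translate t).
Proof. by move=> a f g; apply: val_inj; apply/funext. Qed.

HB.instance Definition _ t := GRing.isLinear.Build R[i] Cc Cc *:%R
  (translate t) (translate_is_linear t).

Lemma translate_continuous t : continuous (translate t).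
Proof.
move=> f V [W [aW kW] WV].
exists [set g | W (translate t g)]; last first.
  by move=> g /= Wg; apply: WV; rewrite -linearB.
split=> [u v a b Wu Wv ab /=|K cK].
  by rewrite linearD !linearZ; exact: aW.
have ct : compact ((fun x => x + t) @` K).
  apply: continuous_compact => //; apply/continuous_subspaceT => x.
  by have /= := @subr_continuous (- t) x; rewrite opprK.
have [e e0 eW] := kW _ ct; exists e => // g gK ge; apply: eW => [|x]; last exact: ge.
by move=> x /tsupport_translate[y gy <-]; exists y => //; exact: gK.
Qed.

End translation.

Section complex_measures.
Context (R : realType) (G : topologicalZmodType).

(* A complex measure on G is, in the sense of Riesz-Markov, a continuous
   linear functional on Cc R G. *)
Record cmeasure := CMeasure {
  cm_fun :> {linear Cc R G -> R[i]^o};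
  cm_cont : continuous cm_fun }.

HB.instance Definition _ := gen_eqMixin cmeasure.
HB.instance Definition _ := gen_choiceMixin cmeasure.
(* The vague (weak-* ) topology is that of pointwise convergence on Cc R G. *)
HB.instance Definition _ := Topological.copy cmeasure
  (initial_topology (fun nu : cmeasure => (nu : _ -> _) : {ptws Cc R G -> R[i]^o})).

Fact cm_act_subproof t (nu : cmeasure) :
  continuous ([the {linear Cc R G -> R[i]^o} of nu \o translate (- t)]).
Proof.
move=> f; apply: continuous_comp; first exact: translate_continuous.
exact: cm_cont.
Qed.

Definition cm_act (t : G) (nu : cmeasure) : cmeasure :=
  CMeasure (@cm_act_subproof t nu).

Definition translation_bounded : set cmeasure :=
  [set nu | forall f : Cc R G, bounded_fun (fun t : G => nu (translate t f))].

End complex_measures.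

(* The library's measurable types are pointed: x0 is the distinguished point,
   the Borel sigma-algebra does not depend on it. *)
Definition borel (X : topologicalType) (x0 : X) : Type := X.

Section borel.
Context (X : topologicalType) (x0 : X).

HB.instance Definition _ := Choice.on (borel x0).
HB.instance Definition _ := isPointed.Build (borel x0) x0.
HB.instance Definition _ := Measurable.copy (borel x0)
  (g_sigma_algebraType (@open X : set (set (borel x0)))).

End borel.

Section dynamical_systems.
Context (G : topologicalZmodType).

Definition is_action (X : Type) (a : G -> X -> X) :=
  (forall x, a 0 x = x) /\ (forall s t x, a (s + t) x = a s (a t x)).

Record topological_system (X : topologicalType) (a : G -> X -> X) : Prop := {
  ts_compact : compact [set: X];
  ts_hausdorff : hausdorff_space X;
  ts_action : is_action a;
  ts_continuous : continuous (fun p : G * X => a p.1 p.2) }.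

Record measurable_system d (X : measurableType d) (a : G -> X -> X) : Prop := {
  ms_action : is_action a;
  ms_measurable : forall t, measurable_fun [set: X] (a t);
  ms_measurable_orbit : forall x (B : set X), measurable B ->
    <<s @open G >> (a^~ x @^-1` B) }.

Inductive dynamical_system : Type :=
| TopologicalDS (X : topologicalType) (x0 : X) (a : G -> X -> X)
    of topological_system a
| MeasurableDS d (X : measurableType d) (a : G -> X -> X)
    of measurable_system a.

Definition ds_display (S : dynamical_system) : measure_display :=
  match S with
  | TopologicalDS X _ _ _ => sigma_display (@open X)
  | MeasurableDS d _ _ _ => d
  end.

Definition ds_space (S : dynamical_system) : measurableType (ds_display S) :=
  match S with
  | TopologicalDS X x0 _ _ => borel x0
  | MeasurableDS _ X _ _ => X
  end.

Definition ds_act (S : dynamical_system) : G -> ds_space S -> ds_space S :=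
  match S with
  | TopologicalDS _ _ a _ => a
  | MeasurableDS _ _ a _ => a
  end.

Definition invariant_measure (R : realType) (S : dynamical_system)
    (m : {measure set (ds_space S) -> \bar R}) :=
  forall t (B : set (ds_space S)), measurable B ->
    m (@ds_act S t @^-1` B) = m B.

End dynamical_systems.

Section L2.
Local Open Scope quotient_scope.
Context d (X : measurableType d) (R : realType).
Variable m : {measure set X -> \bar R}.
Implicit Types f g : X -> R[i]^o.

Definition modulus f : X -> R := fun x => complex.Re `|f x|.

Definition complex_measurable f :=
  measurable_fun [set: X] (fun x => complex.Re (f x)) /\
  measurable_fun [set: X] (fun x => complex.Im (f x)).

Definition sqint_pred : {pred X -> R[i]^o} :=
  mem [set f | complex_measurable f /\ finite_norm m 2%:E (modulus f)].

Lemma modulusE f x : (modulus f x)%:C = `|f x|.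
Proof. by rewrite /modulus normc_def. Qed.

Lemma modulus_ge0 f x : 0 <= modulus f x.
Proof. by rewrite -ler0c modulusE. Qed.

Lemma modulusD f g x : modulus (f + g) x <= modulus f x + modulus g x.
Proof. by rewrite -lecR rmorphD /= !modulusE ler_normD. Qed.

Lemma modulusZ (a : R[i]) f x : modulus (a *: f) x = complex.Re `|a| * modulus f x.
Proof.
apply: (@complexI R); rewrite rmorphM /= (modulusE f) (modulusE (a *: f))
  (_ : (complex.Re `|a|)%:C = `|a|).
  exact: (normrZ a (f x : R[i]^o)).
by rewrite normc_def.
Qed.

Lemma measurable_modulus f :
  complex_measurable f -> measurable_fun [set: X] (modulus f).
Proof.
move=> [mr mi]; rewrite (_ : modulus f = (fun x =>
    Num.sqrt (complex.Re (f x) ^+ 2 + complex.Im (f x) ^+ 2))).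
  have ms := continuous_measurable_fun (@sqrt_continuous R).
  apply: (measurableT_comp ms).
  by apply: measurable_funD; exact: measurable_funX.
by apply/funext => x; rewrite /modulus normc_def.
Qed.

Lemma complex_measurableZD (a : R[i]) f g : complex_measurable f ->
  complex_measurable g -> complex_measurable (a *: f + g).
Proof.
move=> [fr fi] [gr gi]; split.
- rewrite (_ : (fun x => _) = fun x => complex.Re a * complex.Re (f x)
      - complex.Im a * complex.Im (f x) + complex.Re (g x)); last first.
    by apply/funext => x; rewrite !fctE /GRing.scale/=; case: (f x) (g x) (a) => [? ?] [? ?] [? ?].
  by apply: measurable_funD => //; apply: measurable_funB; exact: measurable_funM.
- rewrite (_ : (fun x => _) = fun x => complex.Re a * complex.Im (f x)
      + complex.Im a * complex.Re (f x) + complex.Im (g x)); last first.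
    by apply/funext => x; rewrite !fctE /GRing.scale/=; case: (f x) (g x) (a) => [? ?] [? ?] [? ?].
  by apply: measurable_funD => //; apply: measurable_funD; exact: measurable_funM.
Qed.

Lemma le_Lnorm2 (g h : X -> R) :
  measurable_fun [set: X] g -> measurable_fun [set: X] h ->
  (forall x, 0 <= g x <= h x) ->
  ('N[m]_2%:E [EFin \o g] <= 'N[m]_2%:E [EFin \o h])%E.
Proof.
move=> mg mh gh; rewrite unlock.
have mp (k : X -> R) : measurable_fun [set: X] k ->
    measurable_fun [set: X] (fun x => (`|k x| `^ 2)%:E).
  move=> mk; apply/measurable_EFinP.
  apply: (measurableT_comp (@measurable_powR R 2)).
  exact: measurableT_comp.
have i0 (k : X -> R) : (0 <= \int[m]_x (`|k x| `^ 2)%:E)%E.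
  by apply: integral_ge0 => x _; rewrite lee_fin powR_ge0.
apply: gt0_ler_poweR; rewrite ?invr_ge0 ?in_itv/= ?leey ?andbT ?i0//.
apply: ge0_le_integral; [by []|by move=> x _; rewrite lee_fin powR_ge0|
  exact: mp|exact: mp|move=> x _].
have /andP[g0 ghx] := gh x; have h0 := le_trans g0 ghx.
by rewrite lee_fin ge0_ler_powR ?nnegrE// !ger0_norm.
Qed.

Fact le12 : (1 <= 2%:E :> \bar R)%E. Proof. by rewrite lee_fin ler1n. Qed.

Lemma sqint_modulus f : f \in sqint_pred -> modulus f \in Lfun m 2%:E.
Proof.
rewrite inE => -[mf nf]; apply/andP; split; rewrite inE//=.
exact: measurable_modulus.
Qed.

Lemma complex_measurable0 : complex_measurable 0.
Proof. by split; exact: measurable_cst. Qed.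

Lemma modulusZD_le (a : R[i]) f g x : 0 <= modulus (a *: f + g) x <=
  (complex.Re `|a| *: modulus f + modulus g) x.
Proof.
rewrite modulus_ge0/=; apply: (le_trans (modulusD _ _ _)).
by rewrite modulusZ.
Qed.

Fact sqint_submod_closed : submod_closed sqint_pred.
Proof.
split => [|a f g fP gP].
  rewrite inE; split; first exact: complex_measurable0.
  rewrite (_ : modulus 0 = cst 0); first exact: (finite_norm_cst0 m le12).
  by apply/funext => x; rewrite /modulus normr0.
have [mf gf] := (set_mem fP, set_mem gP).
rewrite inE; split.
  by apply: complex_measurableZD; [case: mf|case: gf].
have := (Lfun_submod_closed m le12).2 (complex.Re `|a|) _ _
  (sqint_modulus fP) (sqint_modulus gP).
move=> /andP[]; rewrite !inE /= => mh; apply: le_lt_trans.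
apply: le_Lnorm2 => //; last exact: modulusZD_le.
by apply/measurable_modulus/complex_measurableZD; [case: mf|case: gf].
Qed.

HB.instance Definition _ :=
  GRing.isSubmodClosed.Build R[i] (X -> R[i]^o) sqint_pred sqint_submod_closed.

Record sqint := MkSqint { sqint_fun :> X -> R[i]^o; _ : sqint_fun \in sqint_pred }.

HB.instance Definition _ := [isSub for sqint_fun].
HB.instance Definition _ := [Choice of sqint by <:].
HB.instance Definition _ := [SubChoice_isSubLmodule of sqint by <:].

Definition null_pred : {pred sqint} :=
  mem [set f : sqint | {ae m, forall x, f x = 0}].

Fact null_submod_closed : submod_closed null_pred.
Proof.
split => [|a f g]; rewrite !inE; first exact/nearW.
apply: filterS2 => x fx gx.
by rewrite -[LHS]/(a *: f x + g x) fx gx scaler0 addr0.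
Qed.

HB.instance Definition _ :=
  GRing.isSubmodClosed.Build R[i] sqint null_pred null_submod_closed.

Definition L2 : Type := Quotient.quot null_pred.

HB.instance Definition _ := GRing.Zmodule.on L2.
HB.instance Definition _ := EqQuotient.on L2.

Definition L2_fun (u : L2) : X -> R[i]^o := repr u : sqint.
Coercion L2_fun : L2 >-> Funclass.

Lemma L2_eqP (f g : sqint) :
  \pi_L2 f = \pi_L2 g <-> {ae m, forall x, f x = g x}.
Proof.
split=> [/eqP|fg]; [|apply/eqP];
  rewrite piE /Quotient.equiv inE /=.
- by apply: filterS => x /eqP; rewrite subr_eq0 => /eqP.
- by apply: filterS fg => x fg; apply/eqP; rewrite subr_eq0 fg.
Qed.

Lemma L2_repr (f : sqint) : {ae m, forall x, (\pi_L2 f : L2) x = f x}.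
Proof. by apply/L2_eqP; rewrite reprK. Qed.

Lemma L2_piD (f g : sqint) : \pi_L2 (f + g) = \pi_L2 f + \pi_L2 g.
Proof. by rewrite !piE. Qed.

Lemma L2P (u v : L2) : u = v <-> {ae m, forall x, u x = v x}.
Proof. by rewrite -{1}(reprK u) -{1}(reprK v) L2_eqP. Qed.

Definition L2_scale (a : R[i]) (u : L2) : L2 := \pi_L2 (a *: (repr u : sqint)).

Lemma L2_scaleE a (f : sqint) : L2_scale a (\pi_L2 f) = \pi_L2 (a *: f).
Proof.
apply/L2_eqP; have := L2_repr f; apply: filterS => x fx.
by rewrite -[LHS]/(a *: (\pi_L2 f : L2) x) fx.
Qed.

Fact L2_scaleA a b u : L2_scale a (L2_scale b u) = L2_scale (a * b) u.
Proof.
elim/quotW: u => u.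
by rewrite (L2_scaleE b) (L2_scaleE a) (L2_scaleE (a * b)) scalerA.
Qed.

Fact L2_scale1 : left_id 1 L2_scale.
Proof. by elim/quotW => u; rewrite L2_scaleE scale1r. Qed.

Fact L2_scaleDr : right_distributive L2_scale +%R.
Proof.
move=> a; elim/quotW => u; elim/quotW => v.
by rewrite -L2_piD !L2_scaleE -L2_piD scalerDr.
Qed.

Fact L2_scaleDl u : {morph L2_scale^~ u : a b / a + b}.
Proof. by move=> a b /=; elim/quotW: u => u; rewrite !L2_scaleE -L2_piD scalerDl. Qed.

HB.instance Definition _ := GRing.Zmodule_isLmodule.Build R[i] L2
  L2_scaleA L2_scale1 L2_scaleDr L2_scaleDl.

Local Notation N2 f := ('N[m]_2%:E [EFin \o modulus f])%E.

Lemma sqintP (f : sqint) : complex_measurable f /\ (N2 f < +oo)%E.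
Proof. by case: f => f /=; rewrite inE. Qed.

Lemma N2_fin_num (f : sqint) : N2 f \is a fin_num.
Proof.
by rewrite fin_numElt (lt_le_trans ltNy0 (Lnorm_ge0 _ _ _)) (sqintP f).2.
Qed.

Lemma ae_eq_N2 (f g : X -> R[i]^o) : complex_measurable f ->
  complex_measurable g -> {ae m, forall x, f x = g x} -> N2 f = N2 g.
Proof.
move=> mf mg fg; rewrite unlock; congr (_ `^ _)%E.
have mp (k : X -> R[i]^o) : complex_measurable k ->
    measurable_fun [set: X] (fun x => (`|modulus k x| `^ 2)%:E).
  move=> /measurable_modulus mk; apply/measurable_EFinP.
  apply: (measurableT_comp (@measurable_powR R 2)).
  exact: measurableT_comp.
apply: ge0_ae_eq_integral => //=; rewrite ?lee_fin ?powR_ge0//.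
- exact: mp.
- exact: mp.
- by apply: filterS fg => x fgx _; rewrite /modulus fgx.
Qed.

Lemma N2_pi (f : sqint) : N2 (\pi_L2 f : L2) = N2 f.
Proof.
by apply: ae_eq_N2; [case: (sqintP (repr (\pi_L2 f)))|case: (sqintP f)|
  exact: L2_repr].
Qed.

Lemma N2D (f g : sqint) : (N2 (f + g)%R <= N2 f + N2 g)%E.
Proof.
have [[mf _] [mg _]] := (sqintP f, sqintP g).
have m1 := measurable_modulus mf; have m2 := measurable_modulus mg.
apply: le_trans (@eminkowski _ _ _ m _ _ 2%:E m1 m2 le12).
apply: le_Lnorm2; last by move=> x; rewrite modulus_ge0 modulusD.
- have := complex_measurableZD 1 mf mg.
  by rewrite scale1r => /measurable_modulus.
- exact: measurable_funD.
Qed.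

Lemma N2Z (a : R[i]) (f : sqint) :
  (N2 (a *: f)%R = (complex.Re `|a|)%:E * N2 f)%E.
Proof.
pose F := Lfun_Sub le12 (sqint_modulus (valP f)).
have c0 : 0 <= complex.Re `|a| by exact: (modulus_ge0 (fun=> a) point).
have := LnormZ F (complex.Re `|a|); rewrite (ger0_norm c0) => <-.
by apply: eq_Lnorm => x /=; rewrite modulusZ.
Qed.

Lemma L2_scalepi a (f : sqint) : a *: \pi_L2 f = \pi_L2 (a *: f).
Proof. exact: L2_scaleE. Qed.

Definition L2_norm (u : L2) : R[i] := (fine (N2 u))%:C.

Fact L2_ler_normD u v : L2_norm (u + v) <= L2_norm u + L2_norm v.
Proof.
elim/quotW: u => f; elim/quotW: v => g.
rewrite /L2_norm -L2_piD !N2_pi -rmorphD /= lecR -fineD ?N2_fin_num//.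
apply: fine_le; [exact: (N2_fin_num (f + g))| |exact: N2D].
by rewrite fin_numD !N2_fin_num.
Qed.

Fact L2_normrZ a u : L2_norm (a *: u) = `|a| * L2_norm u.
Proof.
elim/quotW: u => f; rewrite L2_scalepi /L2_norm !N2_pi N2Z.
by rewrite fineM ?N2_fin_num// rmorphM; congr (_ * _).
Qed.

Fact L2_normr0_eq0 u : L2_norm u = 0 -> u = 0.
Proof.
elim/quotW: u => f; rewrite /L2_norm N2_pi => /(@complexI R)/eqP.
rewrite fine_eq0 ?N2_fin_num// => /eqP /Lnorm_eq0_eq0 f0.
have -> : 0 = \pi_L2 0 by rewrite !piE.
apply/L2_eqP.
have mf : measurable_fun [set: X] (EFin \o modulus f).
  by apply/measurable_EFinP/measurable_modulus; case: (sqintP f).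
apply: filterS (f0 mf _) => [x /(_ I) /= [fx0]|]; last by rewrite lte_fin.
by apply/eqP; rewrite -normr_eq0 -modulusE fx0.
Qed.

HB.instance Definition _ := Lmodule_isNormed.Build R[i] L2
  L2_ler_normD L2_normrZ L2_normr0_eq0.

(* The class of f, for f square-integrable (and 0 otherwise). *)
Definition L2_class (f : X -> R[i]^o) : L2 := \pi_L2 (insubd (0 : sqint) f).

Lemma L2_classE f : f \in sqint_pred -> {ae m, forall x, L2_class f x = f x}.
Proof.
move=> fP; have := L2_repr (insubd (0 : sqint) f).
by apply: filterS => x ->; rewrite [LHS](congr1 (@^~ x) (insubdK _ fP)).
Qed.

Lemma L2_sqint (u : L2) : (u : X -> R[i]^o) \in sqint_pred.
Proof. exact: valP. Qed.

Definition L2_conj (u : L2) : L2 := L2_class (fun x => (u x)^*).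

Lemma L2_conjE u : {ae m, forall x, L2_conj u x = (u x)^*}.
Proof.
apply: L2_classE; have := L2_sqint u; rewrite !inE => -[[mr mi] nu].
split.
- split.
    rewrite (_ : (fun x => _) = fun x => complex.Re (u x))//.
    by apply/funext => x; case: (u x).
  rewrite (_ : (fun x => _) = fun x => - complex.Im (u x)).
    exact: measurableT_comp.
  by apply/funext => x; case: (u x).
- rewrite (_ : modulus _ = modulus u)//.
  by apply/funext => x; rewrite /modulus normcJ.
Qed.

Definition L2_dot (u v : L2) : R[i] :=
  (\int[m]_x complex.Re (u x * (v x)^*)) +i*
  (\int[m]_x complex.Im (u x * (v x)^*)).

Definition Linfty : set L2 := [set u | finite_norm m +oo%E (modulus u)].

End L2.

Lemma L2_normE d (X : measurableType d) (R : realType)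
    (m : {measure set X -> \bar R}) (u : L2 m) :
  `|u| = (fine ('N[m]_2%:E [EFin \o modulus u])%E)%:C.
Proof. by []. Qed.

Section koopman.
Context (R : realType) (G : topologicalZmodType) (S : dynamical_system G).
Variable m : {measure set (ds_space S) -> \bar R}.

Definition koopman (t : G) (u : L2 m) : L2 m :=
  L2_class m (fun x => u (@ds_act G S (- t) x)).

End koopman.

Lemma ds_act_measurable (G : topologicalZmodType) (S : dynamical_system G) t :
  measurable_fun [set: ds_space S] (@ds_act G S t).
Proof.
case: S => [X x0 a [_ _ _ ca]|d X a [_ ma _]] /=; last exact: ma.
apply: (@measurability _ _ (borel x0) (borel x0) setT (a t) (@open X)) => //.
move=> _ [B oB <-]; rewrite setTI; apply: sub_sigma_algebra.
suff : continuous (a t) by move=> /continuousP; exact.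
move=> x; apply: (@continuous_comp _ _ _ (fun x => (t, x))
  (fun p : G * X => a p.1 p.2)); last exact: ca.
by apply: cvg_pair; [exact: cvg_cst|exact: cvg_id].
Qed.

Lemma koopmanE (R : realType) (G : topologicalZmodType)
    (S : dynamical_system G) (m : {measure set (ds_space S) -> \bar R}) t (u : L2 m) :
  invariant_measure m ->
  {ae m, forall x, koopman t u x = u (@ds_act G S (- t) x)}.
Proof.
move=> im; apply: L2_classE.
have ma := @ds_act_measurable G S (- t).
have := L2_sqint u; rewrite !inE => -[[mr mi] nu]; split.
  by split; [exact: (measurableT_comp mr)|exact: (measurableT_comp mi)].
apply: le_lt_trans nu; rewrite unlock le_eqVlt; apply/orP; left; apply/eqP.
congr (_ `^ _)%E; set a := ds_act _ in ma *.
have mp : measurable_fun [set: ds_space S] (fun x => (`|modulus u x| `^ 2)%:E).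
  apply/measurable_EFinP; apply: (measurableT_comp (@measurable_powR R 2)).
  by apply: measurableT_comp => //; exact: measurable_modulus.
rewrite -[RHS](_ : (\int[pushforward m a]_x (`|modulus u x| `^ 2)%:E)%E = _).
  by rewrite ge0_integral_pushforward// => x _; rewrite lee_fin powR_ge0.
apply: eq_measure_integral => A mA _; exact: im.
Qed.

(* The representation T is not a field: it is koopman, determined by S and m. *)
Record spatial_process (R : realType) (G : topologicalZmodType)
    (S : dynamical_system G) (m : probability (ds_space S) R) := SpatialProcess {
  sp_map :> {linear Cc R G -> L2 m};
  sp_invariant : invariant_measure m;
  sp_continuous : continuous sp_map;
  sp_conj : forall f, L2_conj (sp_map f) = sp_map (Cc_conj f);
  sp_koopman : forall t f, koopman t (sp_map f) = sp_map (translate t f) }.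

Section spatial_processes.
Context (R : realType) (G : topologicalZmodType).

Section full.
Context (S : dynamical_system G) (m : probability (ds_space S) R).
Variable N : spatial_process m.

Definition process_products : set (L2 m) :=
  [set u | exists s : seq (Cc R R[i]^o * Cc R G),
    {ae m, forall x, u x = \prod_(p <- s) p.1 (L2_fun (N p.2) x)}].

Definition linear_span (V : lmodType R[i]) (A : set V) : set V :=
  [set v | exists n (c : 'I_n -> R[i]) (a : 'I_n -> V),
    (forall i, A (a i)) /\ v = \sum_(i < n) c i *: a i].

Definition full_process := dense (linear_span process_products).

End full.

Section equivalence.
Context (S S' : dynamical_system G).
Context (m : probability (ds_space S) R) (m' : probability (ds_space S') R).

(* Stated without a product on L2: u v and U u U v are a priori only
   integrable. *)
Definition multiplicative_Linfty d d' (X : measurableType d)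
    (X' : measurableType d') (mu : {measure set X -> \bar R})
    (mu' : {measure set X' -> \bar R}) (U : L2 mu -> L2 mu') :=
  forall u v w : L2 mu, Linfty u -> Linfty v ->
    {ae mu, forall x, w x = u x * v x} ->
    {ae mu', forall x, U w x = U u x * U v x}.

Record spatial_isomorphism (N : spatial_process m) (N' : spatial_process m')
    (U : {linear L2 m -> L2 m'}) (V : L2 m' -> L2 m) : Prop := {
  si_cancel : cancel U V;
  si_cancelV : cancel V U;
  si_dot : forall u v, L2_dot (U u) (U v) = L2_dot u v;
  si_map : forall f, U (N f) = N' f;
  si_koopman : forall t u, U (koopman t u) = koopman t (U u);
  si_mul : multiplicative_Linfty U;
  si_mulV : multiplicative_Linfty V }.

Definition equivalent_processes (N : spatial_process m)
    (N' : spatial_process m') :=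
  exists (U : {linear L2 m -> L2 m'}) (V : L2 m' -> L2 m),
    spatial_isomorphism N N' U V.

End equivalence.

(* Joint continuity of the induced action, part of being a topological system,
   is not included here: see TBMDS_act. *)
Record is_TBMDS (O : set (cmeasure R G)) : Prop := {
  tb_bounded : O `<=` @translation_bounded R G;
  tb_compact : compact O;
  tb_invariant : forall t nu, O nu -> O (cm_act t nu) }.

Section TBMDS.
Context (O : set (cmeasure R G)) (HO : is_TBMDS O).

Definition TBMDS_act (t : G) (w : O) : O :=
  SigSub (mem_set (tb_invariant HO t (set_mem (valP w)))).

End TBMDS.

End spatial_processes.

(* Main.v *)
(* By a Baire category argument, [N] is bounded from [C_c(K)] to [Linfty] for every
   compact [K]. Hence the set O of the linear functionals [w] on [C_c(G)] such that
   [|w f| <= ess sup |N f|] for all [f] consists of measures, is vaguely compact and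
   invariant, and carries a jointly continuous action.

   A random measure with values in O need not exist pointwise on the underlying
   space, as [C_c(G)] may be non-separable. It exists on the Stone space of the
   measure algebra: an ultrafilter U that contains all the conull sets is mapped to
   the functional [f |-> lim_U N f], and this map [pi] is continuous. Every Borel
   subset B of O has a preimage that agrees, on clopen sets of measure close to 1,
   with a clopen set, i.e. with a measurable set E; putting [m' B := m E] defines
   the measure, without Riesz-Markov or Caratheodory extension.

   In the same sense a function f on the process space may extend continuously to
   [F \o pi] ([matches f F]). This relation is compatible with the algebraic
   operations and with the translations, and it preserves integrals. Every
   square-integrable F has a partner f, by binary expansion, and every
   square-integrable f has a partner F: those f form a closed subspace that contains
   the products [vartheta_1 (N f_1) .. vartheta_n (N f_n)], which span a dense
   subspace. The relation is therefore the graph of the wanted unitary. *)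

Require Import Defs.
From HB Require Import structures.
From mathcomp Require Import all_boot all_order all_algebra.
From mathcomp Require Import all_classical all_reals all_analysis.
From mathcomp Require Import complex.
From mathcomp Require Import measurable_realfun ess_sup_inf lra.
Set Implicit Arguments.
Unset Strict Implicit.
Unset Printing Implicit Defensive.
Import Order.TTheory GRing.Theory Num.Theory.
Import numFieldNormedType.Exports.
Local Open Scope classical_set_scope.
Local Open Scope ring_scope.

(** * Measurability of superlevel and sublevel sets *)

Section superlevel_sets.
Context d (T : measurableType d) (R : realType) (f : T -> R).
Hypothesis mf : measurable_fun [set: T] f.

Lemma measurable_set_gt a : measurable [set x | a < f x].
Proof.
rewrite (_ : [set x | a < f x] = setT `&` f @^-1` `]a, +oo[%classic).
  by apply: mf => //; exact: measurable_itv.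
by rewrite setTI; apply/seteqP; split => x /=; rewrite in_itv/= andbT.
Qed.

Lemma measurable_set_ge a : measurable [set x | a <= f x].
Proof.
rewrite (_ : [set x | a <= f x] = setT `&` f @^-1` `[a, +oo[%classic).
  by apply: mf => //; exact: measurable_itv.
by rewrite setTI; apply/seteqP; split => x /=; rewrite in_itv/= andbT.
Qed.

Lemma measurable_set_le a : measurable [set x | f x <= a].
Proof.
rewrite (_ : [set x | f x <= a] = setT `&` f @^-1` `]-oo, a]%classic).
  by apply: mf => //; exact: measurable_itv.
by rewrite setTI; apply/seteqP; split => x /=; rewrite in_itv/=.
Qed.

End superlevel_sets.

(** * The Stone space of the measure algebra *)

Section conull_ultrafilters.
Context d (T : measurableType d) (R : realType) (m : probability T R).
Implicit Types (A B E : set T) (U : set_system T).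

(* These are the points of the Stone space of the measure algebra of [m]: a
   measurable [A] is the clopen set of the [U] such that [U A]. *)
Definition conull_ultra U := UltraFilter U /\ almost_everywhere m `<=` U.

(** As [A] is not null, the conull sets and [A] together generate a proper filter, which an
    ultrafilter refines. This is how the points of the Stone space detect the measure. *)
Lemma conull_ultra_ex A : measurable A -> m A != 0%E ->
  exists U, conull_ultra U /\ U A.
Proof.
move=> mA A0; have FF : ProperFilter (within A (almost_everywhere m)).
  apply: Build_ProperFilter; rewrite /within /= => /= A0'.
  move/negP: A0; apply; apply/eqP/negligibleP => //.
  apply: negligibleS A0' => x Ax /=; exact.
have [U [uU FU]] := ultraFilterLemma FF; exists U; split; first split=> //.
  move=> B mB; apply: FU; rewrite /within /=.
  by apply: filterS mB => x Bx _.
by apply: FU; rewrite /within /=; exact: nearW.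
Qed.

Lemma conull_ultraU U A B : conull_ultra U -> U (A `|` B) -> U A \/ U B.
Proof.
move=> [uU _] UAB; have [|UnA] := in_ultra_setVsetC A uU; first by left.
right; apply: filterS (filterI UAB UnA) => x [[Ax|//]] nAx.
by case: nAx.
Qed.

(** Only finite unions are covered: an ultrafilter need not be countably complete. *)
Lemma conull_ultra_bigU U (A : nat -> set T) n : conull_ultra U ->
  U (\bigcup_(i < n) A i) -> exists i, U (A i).
Proof.
move=> uU; elim: n => [|n IH].
  by rewrite bigcup_mkord big_ord0 => U0; have [uF _] := uU; have [x []] := filter_ex U0.
rewrite bigcup_mkord big_ord_recr /= -bigcup_mkord => /(conull_ultraU uU)[/IH//|].
by exists n.
Qed.

Lemma conull_ultraC U A : conull_ultra U -> U (~` A) <-> ~ U A.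
Proof.
move=> [uU _]; split=> [UnA UA|nUA]; last by have [|] := in_ultra_setVsetC A uU.
by have [x []] := filter_ex (filterI UA UnA).
Qed.

(* Up to measure [e], [P] holds on a clopen set. Countable unions of clopen sets
   are not clopen, and this sigma-filter absorbs the difference: see
   [most_bigcup]. *)
Definition most : set_system (set_system T) :=
  [set P | forall e : R, 0 < e -> exists2 A, measurable A /\ (m (~` A) < e%:E)%E &
    forall U, conull_ultra U -> U A -> P U].

Lemma most_all (P : set (set_system T)) :
  (forall U, conull_ultra U -> P U) -> most P.
Proof.
move=> HP e e0; exists setT => [|U cU _]; last exact: HP.
by rewrite setCT measure0 lte_fin.
Qed.

Lemma most_bigcap (P : nat -> set (set_system T)) :
  (forall n, most (P n)) -> most (\bigcap_n P n).
Proof.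
move=> mP e e0.
(* These bounds sum up to at most [e / 2]; the extra half makes the final bound by [e] strict. *)
have e2 n : 0 < e / 2 / (2 ^ n.+1)%:R by rewrite !divr_gt0// ltr0n expn_gt0.
have /choice[A HA] n : exists A, (measurable A /\ (m (~` A) < (e / 2 / (2 ^ n.+1)%:R)%:E)%E) /\
    forall U, conull_ultra U -> U A -> P n U.
  by have [A HA HP] := mP n _ (e2 n); exists A.
exists (\bigcap_n A n) => [|U cU UA n _].
  have mA n : measurable (A n) by have [[]] := HA n.
  split; first exact: bigcap_measurable.
  rewrite setC_bigcap; apply: (@le_lt_trans _ _ (e / 2)%:E); last first.
    by rewrite lte_fin ltr_pdivrMr// ltr_pMr// ltr1n.
  apply: le_trans (epsilon_trick0 xpredT (ltW (divr_gt0 e0 (ltr0n _ 2)))).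
  apply: (@le_trans _ _ (\sum_(0 <= n <oo) m (~` A n))%E).
    apply: measure_sigma_subadditive => //.
    - by move=> n; exact: measurableC.
    - by apply: bigcup_measurable => n _; exact: measurableC.
  by apply: lee_nneseries => // n _; have [[_ /ltW]] := HA n.
have [_ ] := HA n; apply => //; have [uU _] := cU.
by apply: filterS UA => x; exact.
Qed.

Global Instance most_filter : Filter most.
Proof.
split; first exact: most_all.
- move=> P Q mP mQ.
  (* The binary intersection is that of the sequence [P], [Q], [Q], ... *)
  have := @most_bigcap (fun n => if n is 0%N then P else Q).
  move=> H e e0; have [|A HA HPQ] := H _ e e0; first by case.
  exists A => // U cU UA; have PQ := HPQ U cU UA.
  by split; [exact: (PQ 0%N)|exact: (PQ 1%N)].
- move=> P Q PQ mP e e0; have [A HA HP] := mP e e0.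
  by exists A => // U cU UA; apply/PQ/HP.
Qed.

Lemma most_conull : most conull_ultra. Proof. exact: most_all. Qed.

(** In contrast to [filterS], the implication may use that [U] is a conull ultrafilter. *)
Lemma mostS (P Q : set (set_system T)) :
  (forall U, conull_ultra U -> P U -> Q U) -> most P -> most Q.
Proof.
by move=> PQ mP; apply: (@filterS2 _ most _ _ _ _ _ most_conull mP) => U; exact: PQ.
Qed.

Lemma mostS2 (P Q S : set (set_system T)) :
  (forall U, conull_ultra U -> P U -> Q U -> S U) -> most P -> most Q -> most S.
Proof.
move=> PQ mP mQ; apply: (@filterS3 _ most _ _ _ _ _ _ most_conull mP mQ) => U.
exact: PQ.
Qed.

(** A clopen set [B] on which no [U] contains [A] meets [A] in a null set, by [conull_ultra_ex];
    hence [m A] is at most the measure of the complement of [B], which is arbitrarily small. *)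
Lemma most_null A : measurable A -> most [set U | ~ U A] -> m A = 0%E.
Proof.
move=> mA HA; apply/eqP; rewrite eq_le measure_ge0 andbT.
apply/lee_addgt0Pr => e e0; rewrite add0e.
have [B [mB Be] HB] := HA e e0.
have AB0 : m (A `&` B) = 0%E.
  apply/eqP/negPn/negP => AB0.
  have [U [cU UAB]] := conull_ultra_ex (measurableI _ _ mA mB) AB0.
  have [uU _] := cU.
  by apply: (HB U cU); apply: filterS UAB => x [].
apply: (@le_trans _ _ (m (A `&` B) + m (~` B))%E); last first.
  by rewrite AB0 add0e ltW.
apply: le_trans (measureU2 _ _ _); [|exact: measurableI|exact: measurableC].
rewrite le_measure ?inE//.
  by apply: measurableU; [exact: measurableI|exact: measurableC].
move=> x Ax; have [Bx|nBx] := pselect (B x); [by left|by right].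
Qed.

Lemma null_most A : m.-negligible A -> most [set U | ~ U A].
Proof.
move=> A0; apply: most_all => U cU; apply/(conull_ultraC _ cU).
by have [_] := cU; apply; rewrite /almost_everywhere setCK.
Qed.

(** A finite union [B N] exhausts the whole union [D] up to measure [e]. An ultrafilter that
    contains [D] and avoids the remainder [D] minus [B N] contains [B N], hence one of finitely many
    [A i]. *)
Lemma most_bigcup (A : nat -> set T) : (forall n, measurable (A n)) ->
  most [set U | U (\bigcup_n A n) -> exists n, U (A n)].
Proof.
move=> mA e e0; pose D := \bigcup_n A n; pose B n := \bigcup_(i < n) A i.
have mB n : measurable (B n) by apply: bigcup_measurable.
have mD : measurable D by apply: bigcup_measurable.
have : m \o (fun n => D `\` B n) @ \oo --> m (\bigcap_n (D `\` B n)).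
  apply: nonincreasing_cvg_mu => //.
  - by rewrite -ge0_fin_numE// fin_num_measure//; exact: measurableD.
  - by move=> n; exact: measurableD.
  - by apply: bigcap_measurable => // n _; exact: measurableD.
  - move=> n k nk; apply/subsetPset => x [Dx nBx]; split=> // -[i /= ik Ax].
    by apply: nBx; exists i => //=; exact: leq_trans nk.
have -> : \bigcap_n (D `\` B n) = set0.
  rewrite -subset0 => x Hx; have [[i _ Aix] _] := Hx 0%N I.
  by have [_] := Hx i.+1 I; apply; exists i => /=.
rewrite measure0 => /fine_cvgP[_ /cvgrPdist_lt/(_ e e0)] [N _ /(_ N (leqnn _))].
rewrite /= sub0r normrN ger0_norm ?fine_ge0// => De.
exists (~` (D `\` B N)).
  split; first by apply/measurableC/measurableD.
  rewrite setCK -[X in (X < _)%E]fineK ?lte_fin// fin_num_measure//.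
  exact: measurableD.
move=> U cU UDB UD; apply: (conull_ultra_bigU (n := N) cU).
have [uU _] := cU.
apply: filterS (filterI UDB UD) => x [nDB Dx].
by apply: contrapT => nBx; apply: nDB.
Qed.

End conull_ultrafilters.
Arguments most {d T R} m _.

(** * The image measure *)

Section pushed_measure.
Context d (T : measurableType d) (R : realType) (m : probability T R).
Context (Y : topologicalType) (y0 : Y).

(* A map that is continuous on the Stone space of the measure algebra. *)
Record ultra_map := UltraMap {
  ultra_fun :> set_system T -> Y;
  ultra_funP : forall U V, conull_ultra m U -> nbhs (ultra_fun U) V ->
    exists A, [/\ measurable A, U A &
      forall W, conull_ultra m W -> W A -> V (ultra_fun W)] }.

(* [E] represents, up to null sets, the preimage of [B] under [pi]. *)
Definition corr (pi : ultra_map) (E : set T) (B : set Y) :=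
  measurable E /\ most m [set U | U E <-> B (pi U)].

Section corr.
Variable pi : ultra_map.
Local Notation corr := (corr pi).

(** Most ultrafilters do not contain [E] minus [E'], so this difference is null. In particular all
    the representatives of one Borel set have the same measure. *)
Lemma corr_le E E' B B' : corr E B -> corr E' B' -> B `<=` B' -> (m E <= m E')%E.
Proof.
move=> [mE cE] [mE' cE'] BB'.
have E0 : m (E `\` E') = 0%E.
  apply: most_null; first exact: measurableD.
  apply: mostS2 cE cE' => U cU EB EB' UE.
  have [uU _] := cU.
  have UE1 : U E by apply: filterS UE => x [].
  have : U (~` E') by apply: filterS UE => x [].
  by move=> /(conull_ultraC _ cU); apply; apply/EB'/BB'/EB.
apply: (@le_trans _ _ (m (E' `|` (E `\` E')))).
  rewrite le_measure ?inE//; last by move=> x Ex; have [?|?] := pselect (E' x); [left|right].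
  by apply: measurableU => //; exact: measurableD.
apply: (@le_trans _ _ (m E' + m (E `\` E'))%E); last by rewrite E0 adde0.
by apply: measureU2 => //; exact: measurableD.
Qed.

Lemma corr_uniq E E' B : corr E B -> corr E' B -> m E = m E'.
Proof. by move=> cE cE'; apply/eqP; rewrite eq_le !(corr_le (B := B) (B' := B)). Qed.

Lemma corr_setC E B : corr E B -> corr (~` E) (~` B).
Proof.
move=> [mE cE]; split; first exact: measurableC.
apply: mostS cE => U cU EB.
split=> [/(conull_ultraC E cU) nE /EB//|nB].
by apply/(conull_ultraC E cU) => /EB.
Qed.

Lemma corr_bigcup E B : (forall n : nat, corr (E n) (B n)) ->
  corr (\bigcup_n E n) (\bigcup_n B n).
Proof.
move=> cEB; have mE n : measurable (E n) by case: (cEB n).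
split; first exact: bigcup_measurable.
have cE n : most m [set U | U (E n) <-> B n (pi U)] by case: (cEB n).
apply: mostS2 (most_bigcup m mE) (most_bigcap cE) => U cU UE UB.
split=> [/UE[n /(UB n I) Bn]|[n _ /(UB n I) Un]]; first by exists n.
by have [uU _] := cU; apply: filterS Un; exact: bigcup_sup.
Qed.

Lemma corr_setI E B E' B' : corr E B -> corr E' B' -> corr (E `&` E') (B `&` B').
Proof.
move=> [mE cE] [mE' cE']; split; first exact: measurableI.
apply: mostS2 cE cE' => U [uU _] EB EB'.
split=> [UE|[/EB UE /EB' UE']]; last exact: filterI.
by split; [apply/EB|apply/EB']; apply: filterS UE => x [].
Qed.

Lemma corr_setU E B E' B' : corr E B -> corr E' B' -> corr (E `|` E') (B `|` B').
Proof.
move=> c c'; rewrite -[E `|` _]setCK -[B `|` _]setCK !setCU.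
by apply/corr_setC/corr_setI; exact: corr_setC.
Qed.

Lemma corr_set0 : corr set0 set0.
Proof.
split => //; apply: most_all => U [uU _].
by split=> // U0; have [] := filter_ex U0.
Qed.

(* The clopen subsets of the preimage of [V] have an essential supremum, which
   is realized by countably many of them. *)
Lemma corr_open V : open V -> exists E, corr E V.
Proof.
move=> oV; pose Q A := measurable A /\ forall W, conull_ultra m W -> W A -> V (pi W).
have Q0 : Q set0 by split=> // W [uW _] W0; have [] := filter_ex W0.
have QU A B : Q A -> Q B -> Q (A `|` B).
  move=> [mA QA] [mB QB]; split; first exact: measurableU.
  by move=> W cW /(conull_ultraU cW)[]; [exact: QA|exact: QB].
pose S := [set fine (m A) | A in Q].
have S1 : has_sup S.
  split; first by exists (fine (m set0)), set0.
  exists 1 => _ [A [mA _] <-]; rewrite -lee_fin fineK ?fin_num_measure//.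
  exact: probability_le1.
(* A maximizing sequence: its union is the essential supremum of the family [Q]. *)
have /choice[A HA] : forall n, exists A, Q A /\ sup S - n.+1%:R^-1 < fine (m A).
  move=> n; have n0 : 0 < n.+1%:R^-1 :> R by rewrite invr_gt0.
  by have [_ [A QA <-] Hs] := sup_adherent n0 S1; exists A.
have mA n : measurable (A n) by case: (HA n) => -[].
exists (\bigcup_n A n); split; first exact: bigcup_measurable.
apply: mostS (most_bigcup m mA) => U cU UA; split.
  by move=> /UA[n UAn]; have [[_ QA] _] := HA n; exact: QA.
move=> VU; have [B [mB UB HB]] := ultra_funP cU (open_nbhs_nbhs (conj oV VU)).
have QB : Q B by [].
(* [B] is a clopen neighbourhood of [U] inside the preimage of [V]. If the union covers it up to a
   null set, then [U], which contains the conull sets, contains the union. *)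
suff : m.-negligible (B `\` \bigcup_n A n).
  move=> B0; have [uU cU'] := cU.
  have UD : U (~` (B `\` \bigcup_n A n)) by apply: cU'; rewrite /almost_everywhere setCK.
  by apply: filterS (filterI UB UD) => x [Bx nBA]; apply: contrapT => nAx; apply: nBA.
have mD n : measurable (B `\` A n) by exact: measurableD.
apply/negligibleP; first by apply: measurableD => //; exact: bigcup_measurable.
apply/eqP; rewrite eq_le measure_ge0 andbT.
(* The union of [A n] and [B] is again in [Q], so its measure is at most [sup S] and [B] adds at
   most [n.+1%:R^-1] to [A n]. *)
have lee n : (m (B `\` \bigcup_n A n) <= (n.+1%:R^-1)%:E)%E.
  apply: (@le_trans _ _ (m (B `\` A n))).
    rewrite le_measure ?inE//; first by apply: measurableD => //; exact: bigcup_measurable.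
    by apply: setDS; exact: bigcup_sup.
  have [QA sA] := HA n.
  have : fine (m (A n `|` B)) <= sup S.
    by apply: sup_ubound; [case: S1|exists (A n `|` B) => //; exact: QU].
  rewrite (_ : A n `|` B = A n `|` (B `\` A n)); last by rewrite setUDr setDv setD0.
  have -> : m (A n `|` (B `\` A n)) = (m (A n) + m (B `\` A n))%E.
    by rewrite measureU// setDIK.
  rewrite fineD ?fin_num_measure// => As.
  rewrite -[X in (X <= _)%E]fineK ?fin_num_measure// lee_fin.
  by rewrite -(lerD2l (fine (m (A n)))) (le_trans As)// -lerBlDr ltW.
apply/lee_addgt0Pr => e e0; rewrite add0e.
have [n _ /(_ n (leqnn n)) ne] := near_infty_natSinv_lt (PosNum e0).
by rewrite (le_trans (lee n))// lee_fin ltW.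
Qed.

(** The sets with a representative form a sigma-algebra, and it contains the open sets. *)
Lemma corr_borel (B : set (borel y0)) : measurable B -> exists E, corr E B.
Proof.
suff : <<s (@open Y : set (set Y)) >> `<=` [set B | exists E, corr E B] by exact.
apply: smallest_sub => [|V oV]; last exact: corr_open.
split.
- by exists set0; exact: corr_set0.
- by move=> A [E cE]; exists (~` E); rewrite setTD; exact: corr_setC.
- move=> A HA; have /choice[E cE] := HA.
  by exists (\bigcup_n E n); exact: corr_bigcup.
Qed.

(* The image under [pi] of the measure of the Stone space, extended at once to
   all the Borel sets, so that no metrizability or regularity is needed. *)
Definition push_measure (B : set (borel y0)) : \bar R :=
  m (xget set0 [set E | corr E B]).

Lemma push_measureE (B : set (borel y0)) E : corr E B -> push_measure B = m E.
Proof.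
move=> cE; apply: corr_uniq (cE).
by apply: (@xgetPex _ set0 [set E | corr E B]); exists E.
Qed.

Let push0 : push_measure set0 = 0%E.
Proof. by rewrite (push_measureE corr_set0) measure0. Qed.

Let push_ge0 B : (0 <= push_measure B)%E.
Proof. exact: measure_ge0. Qed.

Let push_additive : semi_sigma_additive push_measure.
Proof.
move=> B mB tB mUB.
have /choice[E cE] n : exists E, corr E (B n) by exact: corr_borel.
have cEn n : corr (\big[setU/set0]_(k < n) E k) (\big[setU/set0]_(k < n) B k).
  elim: n => [|n IH]; first by rewrite !big_ord0; exact: corr_set0.
  rewrite !big_ord_recr /=; apply: corr_setU => //.
(* The representatives of disjoint sets overlap in null sets at worst. Removing the earlier ones
   makes them disjoint, and they still represent the [B n], which are disjoint already. *)
have cE' n : corr (seqDU E n) (B n).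
  rewrite (_ : B n = seqDU B n); first exact: corr_setI (cE n) (corr_setC (cEn n)).
  apply/seteqP; split=> [x Bnx|x []//]; split=> //.
  rewrite -bigcup_mkord => -[k /= kn Bkx]; move: kn.
  by rewrite (tB k n I I) ?ltnn//; exists x.
rewrite (push_measureE (corr_bigcup cE)) seqDU_bigcup_eq.
rewrite (_ : (fun n => _) = (fun n => \sum_(0 <= i < n) m (seqDU E i))%E).
  apply: measure_semi_sigma_additive => //.
  - by move=> n; case: (cE' n).
  - by apply: bigcup_measurable => n _; case: (cE' n).
apply/funext => n; apply: eq_bigr => i _.
exact: push_measureE.
Qed.

HB.instance Definition _ := isMeasure.Build _ (borel y0) R push_measure
  push0 push_ge0 push_additive.

Let push_setT : push_measure setT = 1%E.
Proof.
have := corr_setC corr_set0; rewrite !setC0 => cT.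
by rewrite (push_measureE cT) probability_setT.
Qed.

HB.instance Definition _ := Measure_isProbability.Build _ (borel y0) R push_measure
  push_setT.

Lemma push_ae (P : set Y) :
  {ae (push_measure : {measure set (borel y0) -> \bar R}), forall y, P y} ->
  most m [set U | P (pi U)].
Proof.
move=> [B [mB B0 PB]]; have [E cE] := corr_borel mB.
have mE0 : m.-negligible E.
  case: (cE) => mE _; apply/negligibleP => //.
  exact: etrans (esym (push_measureE cE)) B0.
case: cE => _ cE; apply: filterS2 cE (null_most mE0) => U EB nE.
by apply: contrapT => nP; apply/nE/EB/PB.
Qed.

End corr.
End pushed_measure.

(** * Functions that match along the map to Y *)

(* [limn_esup] instead of [lim] makes the pointwise limit measurable even where
   the sequence diverges. *)
Definition limr (R : realType) (f : nat -> R) : R := fine (limn_esup (EFin \o f)).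

Lemma limr_cvg (R : realType) (f : nat -> R) l : f @ \oo --> l -> limr f = l.
Proof.
move=> fl; have : EFin \o f @ \oo --> l%:E by apply: cvg_EFin => //; exact: nearW.
by move=> /cvg_limn_einf_sup[_ h]; rewrite /limr h.
Qed.

Lemma measurable_limr d (T : measurableType d) (R : realType) (f : nat -> T -> R) :
  (forall n, measurable_fun setT (f n)) ->
  measurable_fun setT (fun x => limr (f ^~ x)).
Proof.
move=> mf; apply: (measurableT_comp (fine_measurable measurableT)).
apply: (measurable_fun_limn_esup (f := fun n x => (f n x)%:E)) => n.
exact/measurable_EFinP.
Qed.

Section related_functions.
Context d (T : measurableType d) (R : realType) (m : probability T R).
Context (Y : topologicalType) (y0 : Y) (pi : ultra_map m Y).
Local Notation mu := (@push_measure _ T R m Y y0 pi : probability (borel y0) R).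

(* [f] extends by continuity to [F \o pi] on clopen sets of almost full measure;
   this replaces the pullback of [F] along [pi], which has no pointwise meaning. *)
Definition matches (Z : topologicalType) (f : T -> Z) (F : Y -> Z) :=
  most m [set U | f @ U --> F (pi U)].

(** Continuity is asked for only at the values of [F], which admits [ln] in [matches_ex_ge0]. *)
Lemma matches_comp (Z Z' : topologicalType) (h : Z -> Z') f F :
  (forall y, {for F y, continuous h}) -> matches f F -> matches (h \o f) (h \o F).
Proof.
rewrite /matches => ch mf. apply: (@filterS _ (most m)) mf => U fU.
exact: (@cvg_comp _ _ _ f h U _ _ fU (ch (pi U))).
Qed.

Lemma matches_comp2 (Z Z' Z'' : topologicalType) (h : Z -> Z' -> Z'') f F g G :
  continuous (fun p : Z * Z' => h p.1 p.2) -> matches f F -> matches g G ->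
  matches (fun x => h (f x) (g x)) (fun y => h (F y) (G y)).
Proof.
rewrite /matches => ch rf rg; apply: mostS2 rf rg => U [uU _] fU gU.
have fgU : (fun x => (f x, g x)) @ U --> (F (pi U), G (pi U)) by exact: cvg_pair.
exact: cvg_comp fgU (ch _).
Qed.

Lemma matches_cst (Z : topologicalType) (c : Z) : matches (cst c) (cst c).
Proof. by apply: most_all => U [uU _]; exact: cvg_cst. Qed.

Lemma matches_ae (Z : topologicalType) (f f' : T -> Z) F :
  {ae m, forall x, f x = f' x} -> matches f F -> matches f' F.
Proof.
rewrite /matches => ff' rf; apply: mostS rf => U [uU cU] fU.
apply: cvg_trans fU; apply: near_eq_cvg.
exact: cU ff'.
Qed.

Lemma matches_ae_push (Z : topologicalType) (f : T -> Z) F F' :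
  {ae mu, forall y, F y = F' y} -> matches f F -> matches f F'.
Proof.
by rewrite /matches => /push_ae FF' fF; apply: filterS2 FF' fF => U /= ->.
Qed.

Lemma matches_indic E B : corr pi E B -> matches (\1_E : T -> R) (\1_B).
Proof.
move=> [mE cE]; apply: mostS cE => U cU EB.
have [uU _] := cU; rewrite /= indicE; have [By|nBy] := pselect (B (pi U)).
  rewrite mem_set//; have UE : U E by exact/EB.
  by apply: cvg_near_cst; apply: filterS UE => x Ex; rewrite indicE mem_set.
rewrite memNset//; have UE : U (~` E) by apply/(conull_ultraC E cU) => /EB.
by apply: cvg_near_cst; apply: filterS UE => x Ex; rewrite indicE memNset.
Qed.

(** An [e / 3] argument at a single [U]: the approximation of [f] has to be uniform on some member
    of [U], that of [F] is needed only at the point [pi U]. *)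
Lemma matches_lim (K : numFieldType) (Z : normedModType K) (f_ : nat -> T -> Z) f
    (F_ : nat -> Y -> Z) F :
  (forall n, matches (f_ n) (F_ n)) ->
  most m [set U | forall e : K, 0 < e ->
    \forall n \near \oo, \forall x \near U, `|f_ n x - f x| <= e] ->
  most m [set U | F_ ^~ (pi U) @ \oo --> F (pi U)] ->
  matches f F.
Proof.
rewrite /matches => rf ff FF.
apply: mostS2 (most_bigcap rf) (@filterI _ _ (most_filter m) _ _ ff FF).
move=> U [uU _] rfU [/= fU FU].
apply/cvgrPdist_lt => e e0; have e3 : 0 < e / 3 by rewrite divr_gt0.
have /cvgrPdist_lt/(_ _ e3) FU3 := FU.
have [N _ HN] := filterI (fU _ e3) FU3.
have [Hf HF] := HN N (leqnn N).
have /cvgrPdist_lt/(_ _ e3) HF' := rfU N I.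
apply: filterS2 Hf HF' => x xf xF.
rewrite (_ : e = e / 3 + e / 3 + e / 3); last first.
  by rewrite -{1}[e](@divfK _ 3)// ?pnatr_eq0// mulr_natr mulrS mulr2n addrA.
have -> : F (pi U) - f x = (F (pi U) - F_ N (pi U)) +
    (F_ N (pi U) - f_ N x) + (f_ N x - f x) by rewrite !subrKA.
rewrite (le_lt_trans (ler_normD _ _))// ltr_leD//.
by rewrite (le_lt_trans (ler_normD _ _))// ltrD.
Qed.

(** Along [U], [f] may tend to [a] from above, so that [U] contains the superlevel set although
    [F (pi U) = a]. As this set is the union of the [D n], most [U] that contain it contain some
    [D n], which keeps the limit at least [n.+1%:R^-1] above [a]. *)
Lemma matches_gt (f : T -> R) (F : Y -> R) a : measurable_fun setT f -> matches f F ->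
  corr pi [set x | a < f x] [set y | a < F y].
Proof.
rewrite /matches => mf rf; have mD b : measurable [set x | b < f x].
  exact: measurable_set_gt.
split => //; pose D n := [set x | a + n.+1%:R^-1 < f x].
have DE : [set x | a < f x] = \bigcup_n D n.
  apply/seteqP; split => [x /= /ltr_add_invr[k ak]|x [k _]]; first by exists k.
  by apply: lt_trans; rewrite ltrDl invr_gt0.
have mDn n : measurable (D n) by exact: mD.
apply: mostS2 rf (most_bigcup m mDn) => U [uU _] fU UD.
split=> /= [|aF]; last exact: cvgr_gt fU _ aF.
rewrite DE => /UD[n UDn]; apply: (@lt_le_trans _ _ (a + n.+1%:R^-1)).
  by rewrite ltrDl invr_gt0.
rewrite leNgt; apply/negP => Fa.
have [x []] := filter_ex (filterI UDn (cvgr_lt _ fU _ Fa)); rewrite /D /=.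
by move=> /lt_trans /[apply]; rewrite ltxx.
Qed.

(** Layer-cake formula: both integrals are integrals of the measures of superlevel sets, and these
    agree by [matches_gt]. *)
Lemma matches_integral_ge0 (f : T -> R) (F : borel y0 -> R) :
  measurable_fun setT f -> measurable_fun setT F -> matches f F ->
  (forall x, 0 <= f x) -> (forall y, 0 <= F y) ->
  (\int[m]_x (f x)%:E = \int[mu]_y (F y)%:E)%E.
Proof.
move=> mf mF rf f0 F0.
pose X : {RV m >-> R} := mfun_Sub (mem_set mf).
pose X' : {RV mu >-> R} := mfun_Sub (mem_set mF).
have := ge0_expectation_ccdf (X := X) f0.
have := ge0_expectation_ccdf (X := X') F0.
rewrite !expectation_def => -> ->; apply: eq_integral => r _.
rewrite /ccdf /distribution /pushforward.
rewrite (_ : X @^-1` _ = [set x | r < f x]); last first.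
  by apply/seteqP; split => x /=; rewrite in_itv/= andbT.
rewrite (_ : X' @^-1` _ = [set x | r < F x]); last first.
  by apply/seteqP; split => x /=; rewrite in_itv/= andbT.
by symmetry; exact: push_measureE (matches_gt r mf rf).
Qed.

Lemma matches_integral (f : T -> R) (F : borel y0 -> R) :
  measurable_fun setT f -> measurable_fun setT F -> matches f F ->
  (\int[m]_x (f x)%:E = \int[mu]_y (F y)%:E)%E.
Proof.
move=> mf mF rf; rewrite integralE [RHS]integralE.
have cmax : continuous (fun x : R => Num.max x 0).
  by move=> x; apply: continuous_max; [exact: cvg_id|exact: cvg_cst].
have ep (Z : Type) (g : Z -> R) : (EFin \o g)^\+%E = EFin \o (fun x => Num.max (g x) 0).
  by apply/funext => x; rewrite funeposE/= EFin_max.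
have en (Z : Type) (g : Z -> R) : (EFin \o g)^\-%E = EFin \o (fun x => Num.max (- g x) 0).
  by apply/funext => x; rewrite funenegE/= EFin_max.
rewrite !ep !en; congr (_ - _)%E; apply: matches_integral_ge0 => //=.
- exact: measurable_maxr.
- exact: measurable_maxr.
- exact: matches_comp (fun y => cmax (F y)) rf.
- by move=> x; rewrite le_max lexx orbT.
- by move=> x; rewrite le_max lexx orbT.
- by apply: measurable_maxr => //; exact: measurableT_comp.
- by apply: measurable_maxr => //; exact: measurableT_comp.
- have cmaxN : continuous (fun x : R => Num.max (- x) 0).
    by move=> x; apply: continuous_max; [exact: opp_continuous|exact: cvg_cst].
  exact: matches_comp (fun y => cmaxN (F y)) rf.
- by move=> x; rewrite le_max lexx orbT.
- by move=> x; rewrite le_max lexx orbT.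
Qed.

End related_functions.

(** * Partners of real Borel functions *)

Section existence.
Context d (T : measurableType d) (R : realType) (m : probability T R).
Context (Y : topologicalType) (y0 : Y) (pi : ultra_map m Y).

Lemma matchesD (f g : T -> R) F G : matches pi f F -> matches pi g G ->
  matches pi (f \+ g) (F \+ G).
Proof. by apply: matches_comp2; exact: add_continuous. Qed.

(* The binary digits of [F] are indicators of Borel sets, whose representatives
   are the binary digits of [f]. *)
Lemma matches_ex01 (F : borel y0 -> R) : measurable_fun setT F ->
  (forall y, 0 <= F y <= 1) ->
  exists2 f : T -> R, measurable_fun setT f & matches pi f F.
Proof.
move=> mF F01; pose c k : R := 2^-1 ^+ k.
have c0 k : 0 < c k by rewrite exprn_gt0.
have cS k : c k = c k.+1 + c k.+1 by rewrite /c exprS; lra.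
(* [r k] is what remains of [F] after [k] binary digits; [B k] is the set where the next digit is
   1. *)
pose r := fix r k : borel y0 -> R := if k is j.+1 then
  fun y => r j y - c k * \1_[set y | c k <= r j y] y else F.
pose B k := [set y | c k.+1 <= r k y].
have mrB k : measurable_fun setT (r k) /\ measurable (B k).
  have mB j : measurable_fun setT (r j) -> measurable (B j).
    by move=> mr; exact: (@measurable_set_ge _ (borel y0) R (r j) mr).
  suff: measurable_fun setT (r k) by split => //; exact: mB.
  elim: k => // k IH; apply: measurable_funB => //.
  by apply: measurable_funM => //; exact: (@measurable_indic _ (borel y0) R setT (B k) (mB _ IH)).
have /choice[E cE] k : exists E, corr pi E (B k) by apply: corr_borel; case: (mrB k).
pose f_ n x : R := \sum_(i < n) c i.+1 * \1_(E i) x.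
pose F_ n y : R := \sum_(i < n) c i.+1 * \1_(B i) y.
have fF n : matches pi (f_ n) (F_ n).
  elim: n => [|n IH].
    rewrite (_ : f_ 0%N = cst 0); last by apply/funext => x; rewrite /f_ big_ord0.
    rewrite (_ : F_ 0%N = cst 0); last by apply/funext => x; rewrite /F_ big_ord0.
    exact: matches_cst.
  rewrite (_ : f_ n.+1 = f_ n \+ (fun x => c n.+1 * \1_(E n) x)); last first.
    by apply/funext => x; rewrite /f_ big_ord_recr.
  rewrite (_ : F_ n.+1 = F_ n \+ (fun x => c n.+1 * \1_(B n) x)); last first.
    by apply/funext => x; rewrite /F_ big_ord_recr.
  apply: matchesD => //.
  have cc : continuous (fun x : R => c n.+1 * x).
    by move=> z; apply: cvgM; [exact: cvg_cst|exact: cvg_id].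
  exact: matches_comp (fun y => cc (\1_(B n) y)) (matches_indic (cE n)).
(* The interval is closed on the right: for [F y = 1] all the digits are 1 and the remainder equals
   [c k]. *)
have rk k y : 0 <= r k y <= c k.
  elim: k => [|k /andP[r0 rc]]; first by rewrite /c expr0; exact: F01.
  rewrite /= indicE; have [kr|kr] := leP (c k.+1) (r k y).
    by rewrite mem_set// mulr1 subr_ge0 kr lerBlDr -cS.
  by rewrite memNset ?mulr0 ?subr0 ?r0 ?(ltW kr)//= leNgt kr.
have FE n y : F y = F_ n y + r n y.
  elim: n => [|n IH]; first by rewrite /F_ big_ord0 add0r.
  by rewrite /F_ big_ord_recr /= -/(F_ n y) -addrA (addrC (_ * _)) subrK.
have mf n : measurable_fun setT (f_ n).
  apply: measurable_sum => i; apply: measurable_funM => //.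
  by apply: measurable_indic; case: (cE i).
have fS n x : f_ n x <= f_ n.+1 x <= f_ n x + c n.+1.
  rewrite {2 3}/f_ big_ord_recr /= -/(f_ n x) lerDl lerD2l.
  apply/andP; split; first by apply: mulr_ge0 => //; exact: ltW.
  by rewrite ler_piMr// ?indicE ?lern1 ?leq_b1//; exact: ltW.
have fnd x : nondecreasing_seq (f_ ^~ x).
  by apply/nondecreasing_seqP => n; case/andP: (fS n x).
(* The subtracted term is the tail not yet used; it lets the induction telescope. *)
have fub n k x : f_ (n + k)%N x <= f_ n x + c n - c (n + k)%N.
  elim: k => [|k IH]; first by rewrite addn0 addrK.
  rewrite addnS; have /andP[_ h] := fS (n + k)%N x.
  apply: (le_trans h); have := cS (n + k)%N; lra.
have fc n k x : (n <= k)%N -> f_ k x <= f_ n x + c n.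
  by move=> nk; rewrite -(subnKC nk) (le_trans (fub _ _ _))// gerBl ltW.
pose f x := limr (f_ ^~ x).
have fl x : f_ ^~ x @ \oo --> f x.
  have : cvgn (f_ ^~ x).
    apply: nondecreasing_is_cvgn => //.
    by exists (f_ 0%N x + c 0%N) => _ [n _ <-]; exact: fc.
  by move=> /cvg_ex[l fl]; rewrite /f (limr_cvg fl).
exists f; first exact: measurable_limr.
have c_0 : c @ \oo --> 0 by apply: cvg_expr; rewrite ger0_norm//; lra.
have c_lt e : 0 < e -> \forall n \near \oo, c n < e.
  exact: cvgr_lt c_0 e.
apply: (matches_lim fF); apply: most_all => U [uU _].
  move=> e e0; apply: filterS (c_lt _ e0) => n ce.
  apply: nearW => x; rewrite distrC ger0_norm; last first.
    rewrite subr_ge0; apply: (cvgr_to_ge (fl x)).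
    by exists n => // k /= nk; exact: fnd.
  rewrite lerBlDl; apply: (cvgr_to_le (fl x)).
  by exists n => // k /= nk; rewrite (le_trans (fc _ _ _ nk))// lerD2l; exact: ltW.
apply/cvgrPdist_le => e e0; apply: filterS (c_lt _ e0) => n ce.
have /andP[r0 rc] := rk n (pi U).
by rewrite (FE n) addrAC subrr add0r ger0_norm// (le_trans rc)//; exact: ltW.
Qed.

(* [F] is mapped into [0, 1] by [t |-> expR (- t)], whose inverse is continuous at
   the values taken. *)
Lemma matches_ex_ge0 (F : borel y0 -> R) : measurable_fun setT F ->
  (forall y, 0 <= F y) ->
  exists2 f : T -> R, measurable_fun setT f & matches pi f F.
Proof.
move=> mF F0.
have [|y|g mg gG] := @matches_ex01 (fun y => expR (- F y)).
- have mN : measurable_fun setT (fun y => - F y) by exact: measurableT_comp.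
  exact: measurableT_comp (@measurable_expR R) mN.
- by rewrite expR_ge0/= expR_le1 oppr_le0.
exists (fun x => - ln (g x)).
  have ml := measurableT_comp (@measurable_ln R) mg.
  exact: measurableT_comp ml.
rewrite (_ : F = (fun t => - ln t) \o (fun y => expR (- F y))); last first.
  by apply/funext => y /=; rewrite expRK opprK.
apply: matches_comp gG => y.
by apply: continuousN; apply: continuous_ln; exact: expR_gt0.
Qed.

Lemma matches_ex (F : borel y0 -> R) : measurable_fun setT F ->
  exists2 f : T -> R, measurable_fun setT f & matches pi f F.
Proof.
move=> mF.
have [|//|f mf fF] := @matches_ex_ge0 (fun y => Num.max (F y) 0).
- exact: measurable_maxr.
- by move=> y; rewrite le_max lexx orbT.
have [|//|g mg gF] := @matches_ex_ge0 (fun y => Num.max (- F y) 0).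
- by apply: measurable_maxr => //; exact: measurableT_comp.
- by move=> y; rewrite le_max lexx orbT.
exists (fun x => f x + - g x).
  by apply: measurable_funD => //; exact: measurableT_comp.
rewrite (_ : F = (fun y => Num.max (F y) 0 + - Num.max (- F y) 0)).
  apply: matchesD => //.
  have co : continuous (fun z : R => - z) by exact: opp_continuous.
  exact: matches_comp (fun y => co _) gF.
apply/funext => y; have [F0|F0] := leP 0 (F y).
  by rewrite max_r ?subr0// oppr_le0.
by rewrite max_l ?oppr_ge0 1?ltW// opprK add0r.
Qed.

End existence.

Local Open Scope complex_scope.

(** * Complex-valued functions *)

Section complex_continuity.
Context (R : realType).

Lemma normc_le_ReIm (z : R[i]) : `|z| <= (`|complex.Re z| + `|complex.Im z|)%:C.
Proof.
case: z => a b; rewrite normc_def lecR/=.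
rewrite -[leRHS]ger0_norm ?addr_ge0// -sqrtr_sqr; apply: ler_wsqrtr.
by rewrite sqrrD !real_normK ?num_real// lerD2r lerDl mulrn_wge0// mulr_ge0.
Qed.

Lemma Re_normc (z : R[i]) : (complex.Re `|z|)%:C = `|z|.
Proof. by rewrite normc_def. Qed.

Lemma Re_gt0K (e : R[i]) : 0 < e -> (complex.Re e)%:C = e.
Proof. by move=> e0; rewrite RRe_real// ger0_real// ltW. Qed.

Lemma normc_ge_Im (z : R[i]) : `|complex.Im z|%:C <= `|z|.
Proof.
rewrite normc_def lecR -sqrtr_sqr; apply: ler_wsqrtr.
by rewrite lerDr sqr_ge0.
Qed.

Lemma continuous_Re : continuous (fun z : R[i]^o => complex.Re z : R).
Proof.
move=> z V [e /= e0 eV]; exists e%:C; first by rewrite /= ltcR.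
move=> w; rewrite /ball_/= => zw; apply: eV; rewrite /ball_/= -ltcR.
by apply: le_lt_trans zw; rewrite -raddfB; exact: normc_ge_Re.
Qed.

Lemma continuous_Im : continuous (fun z : R[i]^o => complex.Im z : R).
Proof.
move=> z V [e /= e0 eV]; exists e%:C; first by rewrite /= ltcR.
move=> w; rewrite /ball_/= => zw; apply: eV; rewrite /ball_/= -ltcR.
by apply: le_lt_trans zw; rewrite -raddfB; exact: normc_ge_Im.
Qed.

Lemma continuous_mulc : continuous (fun p : R[i]^o * R[i]^o => p.1 * p.2 : R[i]^o).
Proof. exact: (@scale_continuous R[i] R[i]^o). Qed.

Lemma continuous_complex : continuous (fun p : R * R => (p.1 +i* p.2) : R[i]^o).
Proof.
move=> [a b] V [e /= e0 eV].
have eE := Re_gt0K e0.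
have e2 : 0 < complex.Re e / 2 by rewrite divr_gt0// -ltcR eE.
exists (ball a (complex.Re e / 2), ball b (complex.Re e / 2)) => /=.
  by split; exact: nbhsx_ballx.
move=> [c d] /= []; rewrite -!ball_normE/= => ac bd; apply: eV; rewrite /ball_/=.
apply: (le_lt_trans (normc_le_ReIm _)); rewrite -eE ltcR /=.
by rewrite (splitr (complex.Re e)) ltrD.
Qed.

Lemma continuous_modulus : continuous (fun z : R[i]^o => complex.Re `|z| : R).
Proof.
move=> z; apply: (@continuous_comp _ R[i]^o _ (fun z : R[i]^o => `|z| : R[i]^o)).
  exact: (@norm_continuous _ R[i]^o).
exact: continuous_Re.
Qed.

End complex_continuity.

Section matches_complex.
Context d (T : measurableType d) (R : realType) (m : probability T R).
Context (Y : topologicalType) (y0 : Y) (pi : ultra_map m Y).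
Local Notation mu := (@push_measure _ T R m Y y0 pi : probability (borel y0) R).
Local Notation matches := (matches pi).
Implicit Types (f g : T -> R[i]^o) (F G : borel y0 -> R[i]^o).

Lemma matches_Re f F : matches f F ->
  matches (fun x => complex.Re (f x) : R) (fun x => complex.Re (F x) : R).
Proof. exact: matches_comp (fun y => @continuous_Re R (F y)). Qed.

Lemma matches_Im f F : matches f F ->
  matches (fun x => complex.Im (f x) : R) (fun x => complex.Im (F x) : R).
Proof. exact: matches_comp (fun y => @continuous_Im R (F y)). Qed.

Lemma matches_modulus f F : matches f F -> matches (modulus f) (modulus F).
Proof. exact: matches_comp (fun y => @continuous_modulus R (F y)). Qed.

Lemma matches_conj f F : matches f F ->
  matches (fun x => (f x)^* : R[i]^o) (fun x => (F x)^* : R[i]^o).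
Proof. exact: matches_comp (fun y => @conj_continuous R (F y)). Qed.

Lemma matches_add f g F G : matches f F -> matches g G ->
  matches (fun x => f x + g x : R[i]^o) (fun y => F y + G y : R[i]^o).
Proof. by apply: matches_comp2; exact: add_continuous. Qed.

Lemma matches_mul f g F G : matches f F -> matches g G ->
  matches (fun x => f x * g x : R[i]^o) (fun x => F x * G x : R[i]^o).
Proof. by apply: matches_comp2; exact: continuous_mulc. Qed.

Lemma matches_scale a f F : matches f F ->
  matches (fun x => a * f x : R[i]^o) (fun y => a * F y : R[i]^o).
Proof.
have ca : continuous (fun z : R[i]^o => a *: z) by exact: (@scaler_continuous _ R[i]^o).
exact: matches_comp (fun y => ca (F y)).
Qed.

Lemma matches_sub f g F G : matches f F -> matches g G ->
  matches (fun x => f x - g x : R[i]^o) (fun y => F y - G y : R[i]^o).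
Proof.
by apply: (matches_comp2 (h := fun a b : R[i]^o => a - b)); exact: sub_continuous.
Qed.

Lemma matches_complex_ex (F : borel y0 -> R[i]^o) : complex_measurable F ->
  exists2 f : T -> R[i]^o, complex_measurable f & matches f F.
Proof.
move=> [mr mi].
have [a ma aF] := @matches_ex _ T R m Y y0 pi _ mr.
have [b mb bF] := @matches_ex _ T R m Y y0 pi _ mi.
exists (fun x => a x +i* b x); first by split.
rewrite (_ : F = (fun y => complex.Re (F y) +i* complex.Im (F y))).
  exact: matches_comp2 (@continuous_complex R) aF bF.
by apply/funext => y; case: (F y).
Qed.

Lemma matches_N2 f (F : borel y0 -> R[i]^o) :
  complex_measurable f -> complex_measurable F -> matches f F ->
  ('N[m]_2%:E [EFin \o modulus f] = 'N[mu]_2%:E [EFin \o modulus F])%E.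
Proof.
move=> mf mF fF; rewrite unlock; congr (_ `^ _)%E.
have sq (r : R) : (`|r| `^ 2)%:E = (r * r)%:E.
  by rewrite powR_mulrn// real_normK ?num_real// expr2.
under eq_integral do rewrite /= sq.
under [RHS]eq_integral do rewrite /= sq.
have mm := measurable_modulus mf; have mM := measurable_modulus mF.
have h := matches_modulus fF.
apply: matches_integral; [exact: measurable_funM|exact: measurable_funM|].
have c2 : continuous (fun x : R => x * x).
  by move=> x; apply: cvgM; exact: cvg_id.
exact: matches_comp (fun y => c2 (modulus F y)) h.
Qed.

Lemma matches_sqint f F :
  complex_measurable f -> complex_measurable F -> matches f F ->
  (f \in sqint_pred m) = (F \in sqint_pred mu).
Proof.
move=> mf mF fF; apply/idP/idP; rewrite !inE => -[_ h]; split => //; move: h;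
  by rewrite /finite_norm (matches_N2 mf mF fF).
Qed.

(** The set where the modulus is positive represents the empty set, so it is null. *)
Lemma matches_eq0 f : complex_measurable f -> matches f (cst 0) ->
  {ae m, forall x, f x = 0}.
Proof.
move=> mf /matches_modulus f0.
have [mE] := matches_gt 0 (measurable_modulus mf) f0.
have -> : [set y | 0 < modulus (cst 0 : borel y0 -> R[i]^o) y] = set0.
  by rewrite -subset0 => y /=; rewrite /modulus normr0 ltxx.
move=> cE; have E0 : m [set x | 0 < modulus f x] = 0%E.
  apply: most_null => //; apply: mostS cE => U cU UE.
  by move=> /UE.
exists [set x | 0 < modulus f x]; split => // x /= fx; rewrite lt_def modulus_ge0 andbT.
by apply: contra_notN fx => /eqP f0'; apply/eqP; rewrite -normr_eq0 -modulusE f0'.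
Qed.

Lemma matches_0eq F : complex_measurable F -> matches (cst 0) F ->
  {ae mu, forall y, F y = 0}.
Proof.
move=> mF /matches_modulus f0.
have := matches_gt 0 (measurable_modulus (@complex_measurable0 _ T R)) f0.
have -> : [set y | 0 < modulus (0 : T -> R[i]^o) y] = set0.
  by rewrite -subset0 => y /=; rewrite /modulus normr0 ltxx.
move=> /push_measureE; rewrite measure0 => E0.
have mS : measurable [set y | 0 < modulus F y].
  exact: (@measurable_set_gt _ (borel y0) R (modulus F) (measurable_modulus mF)).
exists [set y | 0 < modulus F y]; split; [exact: mS|exact: E0|] => x /= fx.
rewrite lt_def modulus_ge0 andbT.
by apply: contra_notN fx => /eqP f0'; apply/eqP; rewrite -normr_eq0 -modulusE f0'.
Qed.

End matches_complex.

Local Open Scope quotient_scope.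

(** * Matching square-integrable functions *)

Lemma cauchy_complex (R : realType) (a : nat -> R[i]^o) :
  (forall e : R, 0 < e -> exists N, forall n k, (N <= n)%N -> (N <= k)%N ->
    `|a n - a k| <= e%:C) -> exists l : R[i]^o, a @ \oo --> l.
Proof.
move=> ca; have cr (g : R[i]^o -> R) : (forall z w, `|g z - g w|%:C <= `|z - w|) ->
    cvgn (g \o a).
  move=> gl; apply: cauchy_cvg; apply: cauchy_exP => e e0.
  have [N HN] := ca _ (divr_gt0 e0 (ltr0n R 2)).
  exists (g (a N)); exists N => // n /= Nn; rewrite -ball_normE /= -ltcR.
  apply: le_lt_trans (gl _ _) _; apply: le_lt_trans (HN _ _ (leqnn N) Nn) _.
  by rewrite ltcR ltr_pdivrMr// ltr_pMr// ltr1n.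
have /cvg_ex[r ar] : cvgn ((fun z : R[i]^o => complex.Re z) \o a).
  by apply: cr => z w; rewrite -raddfB; exact: normc_ge_Re.
have /cvg_ex[i ai] : cvgn ((fun z : R[i]^o => complex.Im z) \o a).
  by apply: cr => z w; rewrite -raddfB; exact: normc_ge_Im.
exists (r +i* i).
rewrite (_ : a = (fun p : R * R => (p.1 +i* p.2) : R[i]^o) \o
    (fun n => (complex.Re (a n), complex.Im (a n)))); last first.
  by apply/funext => n /=; case: (a n).
exact: cvg_comp (cvg_pair ar ai) (@continuous_complex R (r, i)).
Qed.

Section complex_measurable.
Context d (T : measurableType d) (R : realType).
Implicit Types f g : T -> R[i]^o.

Lemma complex_measurable_mul f g : complex_measurable f -> complex_measurable g ->
  complex_measurable (fun x => f x * g x : R[i]^o).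
Proof.
move=> [fr fi] [gr gi]; split.
- rewrite (_ : (fun x => _) = fun x => complex.Re (f x) * complex.Re (g x)
      - complex.Im (f x) * complex.Im (g x)); last first.
    by apply/funext => x; case: (f x) (g x) => [? ?] [? ?].
  by apply: measurable_funB; exact: measurable_funM.
- rewrite (_ : (fun x => _) = fun x => complex.Re (f x) * complex.Im (g x)
      + complex.Im (f x) * complex.Re (g x)); last first.
    by apply/funext => x; case: (f x) (g x) => [? ?] [? ?].
  by apply: measurable_funD; exact: measurable_funM.
Qed.

Lemma complex_measurable_conj f : complex_measurable f ->
  complex_measurable (fun x => (f x)^* : R[i]^o).
Proof.
move=> [fr fi]; split.
- rewrite (_ : (fun x => _) = fun x => complex.Re (f x))//.
  by apply/funext => x; case: (f x).
- rewrite (_ : (fun x => _) = fun x => - complex.Im (f x)); last first.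
    by apply/funext => x; case: (f x).
  exact: measurableT_comp.
Qed.

Lemma complex_measurable_sub f g : complex_measurable f -> complex_measurable g ->
  complex_measurable (fun x => f x - g x : R[i]^o).
Proof.
move=> [fr fi] [gr gi]; split.
- rewrite (_ : (fun x => _) = fun x => complex.Re (f x) - complex.Re (g x)); last first.
    by apply/funext => x; rewrite raddfB.
  exact: measurable_funB.
- rewrite (_ : (fun x => _) = fun x => complex.Im (f x) - complex.Im (g x)); last first.
    by apply/funext => x; rewrite raddfB.
  exact: measurable_funB.
Qed.

End complex_measurable.

Section L2_ae.
Context d (T : measurableType d) (R : realType) (m : {measure set T -> \bar R}).
Implicit Types u v : L2 m.

Lemma L2_addE u v : {ae m, forall x, (u + v : L2 m) x = u x + v x}.
Proof.
by apply: filterS (L2_repr (repr u + repr v)) => x; rewrite L2_piD !reprK.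
Qed.

Lemma L2_zmulE a u : {ae m, forall x, (a *: u : L2 m) x = a * u x}.
Proof.
by apply: filterS (L2_repr (a *: repr u)) => x; rewrite -L2_scalepi reprK.
Qed.

Lemma L2_subE u v : {ae m, forall x, (u - v : L2 m) x = u x - v x}.
Proof.
apply: filterS2 (L2_addE u (- v)) (L2_zmulE (-1) v) => x /= ->.
by rewrite scaleN1r mulN1r => ->.
Qed.

Lemma L2_zeroE : {ae m, forall x, (0 : L2 m) x = 0}.
Proof.
have e : (0 : L2 m) = \pi_(L2 m) 0 by rewrite !piE.
by apply: filterS (L2_repr (0 : sqint m)) => x; rewrite -e.
Qed.

Lemma L2_complex_measurable u : complex_measurable u.
Proof. by have := L2_sqint u; rewrite inE => -[]. Qed.

Lemma L2_chebyshev (a e : R) : 0 < a -> 0 < e -> exists2 c : R, 0 < c &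
  forall u, `|u| < c%:C -> (m [set x | (a <= modulus u x)%R] < e%:E)%E.
Proof.
(* Since [e1 ^+ 2 <= e1 <= e], the constant [a * e1] needs no square root of [e]. *)
move=> a0 e0; pose e1 := Num.min 1 e.
have e10 : 0 < e1 by rewrite lt_min ltr01.
exists (a * e1); first exact: mulr_gt0.
move=> u; rewrite L2_normE ltcR => uc.
have mu := measurable_modulus (L2_complex_measurable u).
set A := [set x | _]; have mA : measurable A by exact: measurable_set_ge.
have mg : measurable_fun setT (fun x => (`|modulus u x| `^ 2)%:E).
  apply/measurable_EFinP; apply: (measurableT_comp (@measurable_powR R 2)).
  exact: measurableT_comp.
have a20 : 0 < a ^+ 2 by rewrite exprn_gt0.
have sq x : `|modulus u x| `^ 2 = modulus u x ^+ 2.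
  by rewrite powR_mulrn// real_normK ?num_real.
have AE : A = setT `&` [set x | ((a ^+ 2)%:E <= `|(`|modulus u x| `^ 2)%:E|)%E].
  rewrite setTI; apply/seteqP; split => x; rewrite /A/= sq lee_fin ger0_norm ?sqr_ge0//;
  by rewrite ler_sqr ?nnegrE ?modulus_ge0// ltW.
have := le_integral_abse m measurableT mg a20; rewrite -AE => h.
rewrite -(@lte_pmul2l _ (a ^+ 2)%:E)//; apply: le_lt_trans h _.
rewrite (_ : (\int[m]_x _)%E = ('N[m]_2%:E [EFin \o modulus u] `^ 2)%E); last first.
  rewrite powR_Lnorm//; apply: eq_integral => x _ /=.
  by rewrite ger0_norm ?powR_ge0.
rewrite -(fineK (N2_fin_num (repr u))) -/(L2_fun u) poweR_EFin -EFinM lte_fin.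
rewrite powR_mulrn ?fine_ge0 ?Lnorm_ge0//.
apply: (@lt_le_trans _ _ ((a * e1) ^+ 2)).
  by rewrite ltr_sqr ?nnegrE ?fine_ge0 ?Lnorm_ge0// ltW// mulr_gt0.
rewrite exprMn ler_pM2l// expr2.
have e11 : e1 <= 1 by rewrite ge_min lexx.
have e1e : e1 <= e by rewrite ge_min lexx orbT.
by apply: le_trans e1e; rewrite ler_piMr//; exact: ltW.
Qed.

End L2_ae.

Section matches_L2.
Context d (T : measurableType d) (R : realType) (m : probability T R).
Context (Y : topologicalType) (y0 : Y) (pi : ultra_map m Y).
Local Notation mu := (@push_measure _ T R m Y y0 pi : probability (borel y0) R).
Local Notation matches u v := (matches pi (u : T -> R[i]^o) (v : borel y0 -> R[i]^o)).
Implicit Types (u : L2 m) (v : L2 mu).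

Lemma L2_add_matches u u' v v' : matches u v -> matches u' v' ->
  matches (u + u' : L2 m) (v + v' : L2 mu).
Proof.
move=> uv uv'; have h := matches_add uv uv'.
have hl : matches (u + u' : L2 m) (fun y => v y + v' y).
  by apply: matches_ae h; apply: filterS (L2_addE u u') => x ->.
by apply: matches_ae_push hl; apply: filterS (L2_addE v v') => x ->.
Qed.

Lemma L2_scale_matches a u v : matches u v ->
  matches (a *: u : L2 m) (a *: v : L2 mu).
Proof.
move=> uv; have h := matches_scale a uv.
have hl : matches (a *: u : L2 m) (fun y => a * v y).
  by apply: matches_ae h; apply: filterS (L2_zmulE a u) => x ->.
by apply: matches_ae_push hl; apply: filterS (L2_zmulE a v) => x ->.
Qed.

Lemma L2_zero_matches : matches (0 : L2 m) (0 : L2 mu).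
Proof.
have h := matches_cst pi (0 : R[i]^o).
have hl : matches (0 : L2 m) (cst 0).
  by apply: matches_ae h; apply: filterS (L2_zeroE m) => x ->.
by apply: matches_ae_push hl; apply: filterS (L2_zeroE mu) => x ->.
Qed.

Lemma L2_norm_matches u v : matches u v -> `|u| = `|v|.
Proof.
move=> uv; rewrite !L2_normE.
by rewrite (matches_N2 (L2_complex_measurable u) (L2_complex_measurable v) uv).
Qed.

Lemma L2_sub_matches u u' v v' : matches u v -> matches u' v' ->
  matches (u - u' : L2 m) (v - v' : L2 mu).
Proof.
move=> uv uv'; have := L2_add_matches uv (L2_scale_matches (-1) uv').
by rewrite !scaleN1r.
Qed.

(** Matching is additive and preserves norms, so [v - v'] has the norm of [u - u]. *)
Lemma L2_matches_inj u v v' : matches u v -> matches u v' -> v = v'.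
Proof.
move=> uv uv'; apply/eqP; rewrite -subr_eq0 -normr_eq0.
by rewrite -(L2_norm_matches (L2_sub_matches uv uv')) subrr normr0.
Qed.

Lemma L2_matches_fun u u' v : matches u v -> matches u' v -> u = u'.
Proof.
move=> uv uv'; apply/eqP; rewrite -subr_eq0 -normr_eq0.
by rewrite (L2_norm_matches (L2_sub_matches uv uv')) subrr normr0.
Qed.

(** [F] inherits square-integrability from [u], through the equality of their norms. *)
Lemma L2_push u (F : borel y0 -> R[i]^o) : complex_measurable F -> matches u F ->
  exists v : L2 mu, matches u v /\ {ae mu, forall y, v y = F y}.
Proof.
move=> mF uF; have FP : F \in sqint_pred mu.
  by rewrite -(matches_sqint (L2_complex_measurable u) mF uF) L2_sqint.
exists (L2_class mu F); split; last exact: L2_classE.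
by apply: matches_ae_push uF; apply: filterS (L2_classE FP) => y ->.
Qed.

Lemma L2_pull v : exists u : L2 m, matches u v.
Proof.
have [f mf fv] := matches_complex_ex pi (L2_complex_measurable v).
have fP : f \in sqint_pred m by rewrite (matches_sqint mf (L2_complex_measurable v) fv) L2_sqint.
exists (L2_class m f); apply: matches_ae fv.
by apply: filterS (L2_classE fP) => y ->.
Qed.

Lemma L2_dot_matches u u' v v' : matches u v -> matches u' v' ->
  L2_dot u u' = L2_dot v v'.
Proof.
move=> uv uv'; have h := matches_mul uv (matches_conj uv').
have [mur mui] := complex_measurable_mul (L2_complex_measurable u)
  (complex_measurable_conj (L2_complex_measurable u')).
have [mvr mvi] := complex_measurable_mul (L2_complex_measurable v)
  (complex_measurable_conj (L2_complex_measurable v')).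
rewrite /L2_dot /Rintegral.
congr (fine _ +i* fine _).
- exact: matches_integral mur mvr (matches_Re h).
- exact: matches_integral mui mvi (matches_Im h).
Qed.

End matches_L2.

(** * Partners of all square-integrable functions, and the unitary *)

Section unitary.
Context d (T : measurableType d) (R : realType) (m : probability T R).
Context (Y : topologicalType) (y0 : Y) (pi : ultra_map m Y).
Local Notation mu := (@push_measure _ T R m Y y0 pi : probability (borel y0) R).
Local Notation matches u v := (matches pi (u : T -> R[i]^o) (v : borel y0 -> R[i]^o)).
Implicit Types (u : L2 m) (v : L2 mu).

(** The union of the [A n] from [N] on has measure at most [2 * 2^-1 ^+ N], which is below [e] for
    large [N]. Thus one [N] serves a whole clopen set. *)
Lemma most_borel_cantelli (A : nat -> set T) : (forall n, measurable (A n)) ->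
  (forall n, (m (A n) < (2^-1 ^+ n)%:E)%E) ->
  most m [set U | exists N, U [set x | forall n, (N <= n)%N -> ~ A n x]].
Proof.
move=> mA Ac e e0; have e20 : 0 < e / 2 by rewrite divr_gt0.
have c_0 : (fun n => 2 * 2^-1 ^+ n : R) @ \oo --> (2 * 0 : R).
  apply: cvgM; first exact: cvg_cst.
  by apply: cvg_expr; rewrite ger0_norm// invf_lt1// ltr1n.
rewrite mulr0 in c_0.
have [N _ /(_ N (leqnn N)) /= cN] := cvgr_lt _ c_0 _ e0.
exists (~` \bigcup_k A (N + k)%N).
  split; first by apply: measurableC; exact: bigcup_measurable.
  rewrite setCK; apply: le_lt_trans (_ : _ <= (2 * 2^-1 ^+ N)%:E)%E _; last by rewrite lte_fin.
  have cN0 : 0 <= 2 * 2^-1 ^+ N :> R by rewrite mulr_ge0// exprn_ge0// invr_ge0.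
  apply: le_trans (epsilon_trick0 xpredT cN0).
  apply: (@le_trans _ _ (\sum_(0 <= k <oo) m (A (N + k)%N))%E).
    by apply: measure_sigma_subadditive => //; exact: bigcup_measurable.
  apply: lee_nneseries => // k _; apply: (le_trans (ltW (Ac _))).
  by rewrite lee_fin exprD natrX exprS invfM mulrACA mulfV ?pnatr_eq0// mul1r !exprVn.
move=> U [uU _] UA; exists N; apply: filterS UA => x nA n Nn An.
by apply: nA; exists (n - N)%N => //; rewrite subnKC.
Qed.

(** Fast convergence in measure becomes, by Borel-Cantelli, uniform convergence on members of [U],
    for most [U]. The partner of [u] is then the pointwise limit of the [v_ n]. *)
Lemma L2_matches_closed u (u_ : nat -> L2 m) (v_ : nat -> L2 mu) :
  (forall n, matches (u_ n) (v_ n)) ->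
  (forall n, (m [set x | (2^-1 ^+ n <= modulus (u_ n - u : L2 m) x)%R] < (2^-1 ^+ n)%:E)%E) ->
  exists v, matches u v.
Proof.
move=> uv uu.
have mA n : measurable [set x | (2^-1 ^+ n <= modulus (u_ n - u : L2 m) x)%R].
  exact: measurable_set_ge (measurable_modulus (L2_complex_measurable _)) _.
have H1 : most m [set U | exists N, forall n, (N <= n)%N ->
    U [set x | complex.Re `|u_ n x - u x| <= 2^-1 ^+ n]].
  apply: mostS (most_borel_cantelli mA uu) => U [uU cU] [N UN]; exists N => n Nn.
  have Ue : U [set x | (u_ n - u : L2 m) x = u_ n x - u x].
    exact: cU (L2_subE (u_ n) u).
  apply: filterS2 UN Ue => x /(_ n Nn) nA e; apply/ltW; rewrite ltNge; apply/negP => h.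
  by apply: nA; rewrite /= /modulus e.
pose F y : R[i]^o := limr (fun n => complex.Re (v_ n y)) +i*
                     limr (fun n => complex.Im (v_ n y)).
have mF : @complex_measurable _ (borel y0) R F.
  split; apply: measurable_limr => n; by case: (L2_complex_measurable (v_ n)).
suff uF : matches u F by have [v [uv' _]] := L2_push mF uF; exists v.
have c_0 : (fun n => 2^-1 ^+ n : R) @ \oo --> (0 : R).
  by apply: cvg_expr; rewrite ger0_norm// invf_lt1// ltr1n.
apply: (matches_lim uv).
  apply: mostS H1 => U [uU _] [N HN] e e0.
  have eE := Re_gt0K e0.
  have e0' : 0 < complex.Re e by rewrite -ltcR eE.
  have [M _ HM] := cvgr_lt _ c_0 _ e0'.
  exists (maxn N M) => // n /=; rewrite geq_max => /andP[Nn Mn].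
  apply: filterS (HN n Nn) => x xn.
  by rewrite -eE -Re_normc lecR (le_trans xn)//; apply/ltW/HM.
apply: mostS2 H1 (most_bigcap uv) => U [uU _] [N HN] uvU.
(* The differences of the [v_ n (pi U)] are limits along [U] of those of the [u_ n], which are
   uniformly small on members of [U]. *)
have [l vl] : exists l : R[i]^o, v_ ^~ (pi U) @ \oo --> l.
  apply: cauchy_complex => e e0.
  have [M _ HM] := cvgr_lt _ c_0 _ (divr_gt0 e0 (ltr0n R 2)).
  exists (maxn N M) => n k; rewrite !geq_max => /andP[Nn Mn] /andP[Nk Mk].
  have fl : (fun x => complex.Re `|u_ n x - u_ k x| : R) @ U -->
      (complex.Re `|v_ n (pi U) - v_ k (pi U)| : R).
    apply: (@cvg_comp _ _ _ (fun x => u_ n x - u_ k x : R[i]^o)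
      (fun z : R[i]^o => complex.Re `|z| : R) _ (nbhs (v_ n (pi U) - v_ k (pi U) : R[i]^o))).
      by apply: cvgB; [exact: uvU n I|exact: uvU k I].
    exact: continuous_modulus.
  rewrite -Re_normc lecR; apply: (cvgr_to_le fl).
  apply: filterS2 (HN n Nn) (HN k Nk) => x xn xk.
  rewrite (splitr e); apply: (le_trans (_ : _ <= 2^-1 ^+ n + 2^-1 ^+ k)); last first.
    by rewrite lerD// ltW//; exact: HM.
  apply: le_trans (lerD xn xk); rewrite -lecR rmorphD/=.
  rewrite !Re_normc.
  by rewrite -(subrKA (u x)) (le_trans (ler_normD _ _))// lerD2l distrC.
suff Fl : F (pi U) = l by rewrite /= Fl.
rewrite /F (limr_cvg (cvg_comp _ _ vl (@continuous_Re R l))).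
by rewrite (limr_cvg (cvg_comp _ _ vl (@continuous_Im R l))); case: l {vl}.
Qed.

Lemma L2_matches_dense (A : set (L2 m)) : dense A ->
  (forall u, A u -> exists v, matches u v) -> forall u, exists v, matches u v.
Proof.
move=> dA HA u.
have H n : exists w : L2 m, (exists v, matches w v) /\
    (m [set x | (2^-1 ^+ n <= modulus (w - u : L2 m) x)%R] < (2^-1 ^+ n)%:E)%E.
  have c0 : 0 < 2^-1 ^+ n :> R by rewrite exprn_gt0.
  (* Both the level and the measure of the exceptional set are [2^-1 ^+ n], as [L2_matches_closed]
     demands. *)
  have [c cp Hc] := L2_chebyshev m c0 c0.
  have [|w [wc Aw]] := dA _ _ (@ball_open _ (L2 m) u c%:C).
    by exists u; apply: ballxx; rewrite ltcR.
  exists w; split; first exact: HA.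
  by apply: Hc; rewrite distrC; move: wc; rewrite -ball_normE.
have /choice[u_ Hu] := H.
have /choice[v_ Hv] n : exists v, matches (u_ n) v by case: (Hu n).
by apply: (L2_matches_closed Hv) => n; case: (Hu n).
Qed.

(** Partners are chosen in both directions; linearity and the inverse laws follow from their
    uniqueness. *)
Lemma unitary_ex : (forall u, exists v, matches u v) ->
  exists (U : {linear L2 m -> L2 mu}) (V : L2 mu -> L2 m),
    [/\ cancel U V, cancel V U, (forall u, matches u (U u : L2 mu)) & (forall v, matches (V v) v)].
Proof.
move=> /choice[U HU]; have /choice[V HV] := @L2_pull _ T R m Y y0 pi.
have lU : linear U.
  move=> a u u'; apply: L2_matches_inj (HU _) _.
  by apply: L2_add_matches => //; exact: L2_scale_matches.
pose UL : {linear L2 m -> L2 mu} := HB.pack U (GRing.isLinear.Build _ _ _ _ U lU).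
exists UL, V; split => //.
- by move=> u; apply: L2_matches_fun (HV _) (HU u).
- by move=> v; apply: L2_matches_inj (HU (V v)) (HV v).
Qed.

End unitary.

(** * Boundedness of the process *)

Lemma CcKD (R : realType) (X : topologicalType) (K : set X) (f g : Cc R X) a :
  CcK K f -> CcK K g -> CcK K (a *: f + g).
Proof.
move=> fK gK x xs; have [|] := @tsupportD R X a (Cc_fun f) (Cc_fun g) x xs.
  exact: fK.
exact: gK.
Qed.

(** Completeness of [CcK K] in the sup norm. In a Hausdorff space [K] is closed, so the support of
    the uniform limit stays in [K]. *)
Lemma Cc_limit (R : realType) (X : topologicalType) (K : set X) (s : nat -> Cc R X)
    (r : nat -> R) : hausdorff_space X -> compact K -> (forall n, CcK K (s n)) ->
  (forall n j x, (n <= j)%N -> `|s j x - s n x| <= (r n)%:C) ->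
  r @ \oo --> (0 : R) ->
  exists f : Cc R X, CcK K f /\ forall n x, `|f x - s n x| <= (r n)%:C.
Proof.
move=> hX cK sK sr r0.
have /choice[f fl] x : exists l : R[i]^o, s ^~ x @ \oo --> l.
  apply: cauchy_complex => e e0.
  have [N _ /(_ N (leqnn N)) rN] := cvgr_lt _ r0 _ (divr_gt0 e0 (ltr0n R 2)).
  exists N => n k Nn Nk; rewrite -(subrKA (s N x)) (le_trans (ler_normD _ _))//.
  rewrite (splitr e) rmorphD /= lerD//.
    by apply: le_trans (sr _ _ _ Nn) _; rewrite lecR ltW.
  by rewrite distrC; apply: le_trans (sr _ _ _ Nk) _; rewrite lecR ltW.
have fr n x : `|f x - s n x| <= (r n)%:C.
  rewrite -Re_normc lecR.
  have h : (fun j => complex.Re `|s j x - s n x| : R) @ \oo -->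
      (complex.Re `|f x - s n x| : R).
    apply: (@cvg_comp _ _ _ (fun j => s j x - s n x : R[i]^o)
      (fun z : R[i]^o => complex.Re `|z| : R) _ (nbhs (f x - s n x : R[i]^o))).
      by apply: cvgB; [exact: fl|exact: cvg_cst].
    exact: continuous_modulus.
  apply: (cvgr_to_le h); exists n => // j /= nj.
  by rewrite -lecR Re_normc; exact: sr.
have f0 x : ~ K x -> f x = 0.
  move=> nKx; have s0 n : s n x = 0.
    apply/eqP; apply: contrapT => /negP sx; apply: nKx; apply: (sK n).
    exact: subset_closure.
  have := fl x; rewrite (_ : s ^~ x = cst 0); last by apply/funext => n; exact: s0.
  by move=> /(@cvg_unique _ (@norm_hausdorff _ R[i]^o)); apply; exact: cvg_cst.
have tf : tsupport f `<=` K.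
  apply: subset_trans (_ : closure K `<=` K); last exact: compact_closed.
  apply: closure_subset => x /= /eqP fx; apply: contrapT => /f0; exact: fx.
have cf : continuous f.
  move=> x; apply/(@cvgrPdist_lt _ R[i]^o) => e e0.
  have eE := Re_gt0K e0.
  have e0' : 0 < complex.Re e / 3 by rewrite divr_gt0// -ltcR eE.
  have [n _ /(_ n (leqnn n)) rn] := cvgr_lt _ r0 _ e0'.
  have [cs _] := CcP (s n).
  have e3 : 0 < e / 3 by rewrite divr_gt0.
  have rn' : (r n)%:C < e / 3.
    by rewrite -eE -(rmorph_nat (real_complex R)) -fmorphV -rmorphM ltcR.
  have /cvgrPdist_lt/(_ _ e3) := cs x.
  apply: filterS => y sy.
  have -> : f x - f y = (f x - s n x) + (s n x - s n y) + (s n y - f y) by rewrite !subrKA.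
  have -> : e = e / 3 + e / 3 + e / 3.
    rewrite -!mulrDl; apply: (canRL (mulfK _)); first by rewrite pnatr_eq0.
    by rewrite mulr_natr !mulrS mulr0n addr0 addrA.
  rewrite (le_lt_trans (ler_normD _ _))// ltrD//.
    by rewrite (le_lt_trans (ler_normD _ _))// ltrD// (le_lt_trans (fr _ _)).
  by rewrite distrC (le_lt_trans (fr _ _)).
have fP : f \in @Cc_pred R X.
  rewrite inE; split => //; apply: (subclosed_compact _ cK tf); exact: tsupport_closed.
by exists (MkCc fP).
Qed.

Section uniform_bound.
Context d (T : measurableType d) (R : realType) (m : probability T R).
Context (X : topologicalType) (hX : hausdorff_space X).
Context (L : {linear Cc R X -> L2 m}) (cL : continuous L).

Definition ess_bound (f : Cc R X) (C : R) :=
  {ae m, forall x, modulus (L f : L2 m) x <= C}.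

Lemma ess_boundD f g C D : ess_bound f C -> ess_bound g D -> ess_bound (f + g) (C + D).
Proof.
move=> fC gD; have h := L2_addE (L f) (L g).
apply: filterS3 fC gD h => x /= fx gx h.
rewrite linearD /modulus h; apply: le_trans (lerD fx gx).
exact: modulusD.
Qed.

Lemma ess_boundZ a f C : ess_bound f C -> ess_bound (a *: f) (complex.Re `|a| * C).
Proof.
move=> fC; apply: filterS2 fC (L2_zmulE a (L f)) => x fx h.
rewrite linearZ [leLHS](_ : _ = complex.Re `|a| * modulus (L f : L2 m) x).
  by apply: ler_wpM2l => //; rewrite -ler0c Re_normc.
by rewrite /modulus h; exact: (modulusZ a (L f : L2 m) x).
Qed.

Lemma ess_boundW f C D : C <= D -> ess_bound f C -> ess_bound f D.
Proof. by move=> CD; apply: filterS => x /le_trans; exact. Qed.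

Lemma linear_sup_continuous (K : set X) (c : R) : compact K -> 0 < c ->
  exists2 e : R, 0 < e & forall f : Cc R X, CcK K f ->
    (forall x, `|f x| <= e%:C) -> `|L f| < c%:C.
Proof.
move=> cK c0; have : nbhs (L 0) (ball (0 : L2 m) c%:C).
  by rewrite linear0; apply: nbhsx_ballx; rewrite ltcR.
move=> /cL[W [_ /(_ K cK)[e e0 We]] WV]; exists e => // f fK fe.
have := WV f; rewrite subr0 => /(_ (We f fK fe)).
by rewrite /= -ball_normE /= sub0r normrN.
Qed.

Hypothesis bL : forall f, Linfty (L f).

Lemma ess_bound_ex f : exists C, ess_bound f C.
Proof.
have := bL f; rewrite /Linfty/= /finite_norm unlock /=.
(* The norm at [+oo] is the essential supremum once the total mass is positive. *)
rewrite probability_setT lte01 => h.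
exists (fine (ess_sup m (abse \o (EFin \o modulus (L f : L2 m))))).
have H := ess_sup_ge m (abse \o (EFin \o modulus (L f : L2 m))).
apply: filterS H => x /= H.
have e0 : (0 <= ess_sup m (abse \o (EFin \o modulus (L f : L2 m))))%E.
  exact: le_trans H.
rewrite -lee_fin fineK ?ge0_fin_numE//; apply: le_trans H.
by rewrite lee_fin ler_norm.
Qed.

(* A whole ball around [s'] avoids the set of the [f] with [ess_bound f k]: by
   Chebyshev, a small L2 error cannot undo an excess on a non-null set. *)
Lemma unbounded_step (K : set X) (s : Cc R X) (r : R) (k : nat) : compact K ->
  (forall (n : nat) (e : R), 0 < e -> exists f : Cc R X,
    [/\ CcK K f, (forall x, `|f x| <= e%:C) & ~ ess_bound f n%:R]) ->
  CcK K s -> 0 < r -> exists s' r', [/\ CcK K s', 0 < r', r' <= r / 2,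
    (forall x, `|s' x - s x| <= (r / 2)%:C) &
    forall f : Cc R X, CcK K f -> (forall x, `|f x - s' x| <= r'%:C) ->
      ~ ess_bound f k%:R].
Proof.
move=> cK H sK r0; have [C sC] := ess_bound_ex s.
have r20 : 0 < r / 2 by rewrite divr_gt0.
(* [L s] is bounded by [C]; a perturbation [f] without the bound [n] therefore leaves [s + f]
   without the bound [k + 1]. *)
pose n := Num.bound `|C + k%:R + 1|.
have nC : C + k%:R + 1 <= n%:R.
  by apply: (le_trans (ler_norm _)); apply/ltW/archi_boundP.
have [f [fK fr fn]] := H n _ r20.
have sfk : ~ ess_bound (s + f) (k%:R + 1).
  move=> sf; apply: fn; apply: (@ess_boundW _ (k%:R + 1 + 1 * C)); first lra.
  have := ess_boundD sf (ess_boundZ (-1) sC).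
  by rewrite scaleN1r addrAC subrr add0r normrN1.
pose A := [set x | k%:R + 1 < modulus (L (s + f) : L2 m) x].
have mA : measurable A.
  exact: measurable_set_gt (measurable_modulus (L2_complex_measurable _)) _.
have A0 : (0 < m A)%E.
  rewrite lt_def measure_ge0 andbT; apply/eqP => A0; apply: sfk.
  by exists A; split => // x /= /negP; rewrite -ltNge.
have fA : (fine (m A))%:E = m A by rewrite fineK// fin_num_measure.
have [|c c0 Hc] := @L2_chebyshev _ T R m 1 (fine (m A)) ltr01.
  by rewrite -lte_fin fA.
have [e e0 He] := linear_sup_continuous cK c0.
exists (s + f), (Num.min (r / 2) e); split.
- by rewrite -[s]scale1r; exact: CcKD.
- by rewrite lt_min r20.
- by rewrite ge_min lexx.
- by move=> x; rewrite -[(s + f) x]/(s x + f x) addrAC subrr add0r.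
- move=> g gK gs gk.
  have gsK : CcK K (g - (s + f)).
    rewrite addrC -scaleN1r; apply: CcKD => //.
    by rewrite -[s]scale1r; exact: CcKD.
  have small : `|L (g - (s + f))| < c%:C.
    apply: He => // x; apply: (le_trans (gs x)).
    by rewrite lecR ge_min lexx orbT.
  have := Hc _ small; rewrite fA ltNge => /negP; apply.
  set B := [set x | 1 <= _].
  have mB : measurable B.
    exact: measurable_set_ge (measurable_modulus (L2_complex_measurable _)) _.
  (* On [A] the modulus of [L (s + f)] exceeds [k + 1]. If that of [L g] is at most [k], the
     difference is at least 1 there, and [B] would be as large as [A]. *)
  have AB : {ae m, forall x, A x -> B x}.
    apply: filterS2 gk (L2_subE (L g) (L (s + f))) => x gx h.
    rewrite /A /B /= linearB /= => Ax.
    have : modulus (L (s + f) : L2 m) x <=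
        modulus (L g : L2 m) x + modulus (L g - L (s + f) : L2 m) x.
      rewrite /modulus h -lecR rmorphD /= !Re_normc.
      rewrite -{1}(subrK (L2_fun (L g) x) (L2_fun (L (s + f)) x)) addrC.
      by rewrite (le_trans (ler_normD _ _))// lerD2l distrC.
    lra.
  have AB0 : m (A `\` B) = 0%E.
    apply/negligibleP; first exact: measurableD.
    by apply: negligibleS AB => x /= [Ax nBx] /(_ Ax).
  rewrite (measureDI m mA mB) [X in (X + _)%E](_ : _ = 0%E)// add0e.
  by rewrite le_measure ?inE//; exact: measurableI.
Qed.

(* Baire category: otherwise the nested balls of [unbounded_step] shrink to some
   [f] for which [L f] is unbounded. *)
Lemma uniform_ess_bound (K : set X) : compact K ->
  exists2 C : R, 0 < C & forall f (r : R), CcK K f -> 0 < r ->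
    (forall x, `|f x| <= r%:C) -> ess_bound f (C * r).
Proof.
move=> cK; apply: contrapT => nC.
have H (n : nat) (e : R) : 0 < e -> exists f : Cc R X,
    [/\ CcK K f, (forall x, `|f x| <= e%:C) & ~ ess_bound f n%:R].
  move=> e0; apply: contrapT => nf; apply: nC.
  (* A counterexample [f] to this constant, rescaled by [e / r], has sup norm at most [e] and lacks
     the bound [n]. The successor keeps the constant positive. *)
  exists (n.+1%:R / e); first by rewrite divr_gt0.
  move=> f r fK r0 fr; apply: contrapT => nfb; apply: nf.
  exists ((e / r)%:C *: f); split.
  - have := @CcKD _ _ K f 0 (e / r)%:C fK; rewrite addr0; apply.
    by rewrite /CcK/= tsupport0.
  - move=> x; rewrite -[X in `|X|]/((e / r)%:C * f x) normrM.
    have er0 : 0 <= e / r by rewrite divr_ge0// ltW.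
    rewrite ger0_norm ?ler0c//; apply: le_trans (ler_wpM2l _ (fr x)) _.
      by rewrite ler0c.
    by rewrite -rmorphM /= divfK// gt_eqF.
  - move=> /(ess_boundZ (r / e)%:C).
    rewrite scalerA -rmorphM mulrA divfK ?gt_eqF// divff ?gt_eqF// scale1r.
    have re0 : 0 <= r / e by rewrite divr_ge0// ltW.
    rewrite ger0_norm ?ler0c//= => h; apply: nfb; apply: ess_boundW h.
    by rewrite [leRHS]mulrAC [_.+1%:R * r]mulrC [leRHS]mulrAC ler_wpM2l// ler_nat.
have /choice[step Hstep] : forall q : nat * (Cc R X * R), exists q' : Cc R X * R,
    CcK K q.2.1 -> 0 < q.2.2 ->
    [/\ CcK K q'.1, 0 < q'.2, q'.2 <= q.2.2 / 2,
    (forall x, `|q'.1 x - q.2.1 x| <= (q.2.2 / 2)%:C) &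
    forall f : Cc R X, CcK K f -> (forall x, `|f x - q'.1 x| <= q'.2%:C) ->
      ~ ess_bound f q.1%:R].
  move=> [k [s r]] /=; have [[sK r0]|nsr] := pselect (CcK K s /\ 0 < r).
    by have [s' [r' h]] := unbounded_step k cK H sK r0; exists (s', r').
  by exists (s, r) => sK r0; case: nsr.
(* Centres and radii of nested balls: no element of the ball [q k.+1] has the essential bound
   [k]. *)
pose q := fix q n : Cc R X * R := if n is k.+1 then step (k, q k) else (0, 1).
have Hq n : CcK K (q n).1 /\ 0 < (q n).2.
  elim: n => [|n [sK r0]] /=; last by have [] := Hstep (n, q n) sK r0.
  by split => //; rewrite /CcK/= tsupport0.
have HS n := Hstep (n, q n) (Hq n).1 (Hq n).2.
have qr n j x : (n <= j)%N -> `|(q j).1 x - (q n).1 x| <= ((q n).2)%:C.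
  (* Each step moves the centre by at most half the radius and at least halves the radius, so the
     displacements telescope. *)
  move=> nj; suff h k : `|(q (n + k)%N).1 x - (q n).1 x| <= ((q n).2 - (q (n + k)%N).2)%:C.
    by rewrite -(subnKC nj) (le_trans (h _))// lecR gerBl; case: (Hq (n + (j - n))%N) => _ /ltW.
  elim: k => [|k IH]; first by rewrite addn0 !subrr normr0.
  have [_ _ h1 h2 _] := HS (n + k)%N; rewrite addnS.
  rewrite -(subrKA ((q (n + k)%N).1 x)) (le_trans (ler_normD _ _))//.
  apply: le_trans (lerD (h2 x) IH) _; rewrite -rmorphD lecR /=.
  move: h1; rewrite /=; lra.
have q0 n : (q n).2 <= 2^-1 ^+ n.
  elim: n => [|n IH]; first by rewrite expr0.
  have [_ _ h1 _ _] := HS n; rewrite exprS; apply: (le_trans h1) => /=.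
  by rewrite mulrC ler_wpM2l.
have r0 : (fun n => (q n).2) @ \oo --> (0 : R).
  apply: (@squeeze_cvgr _ _ _ _ (cst 0) (fun n => 2^-1 ^+ n)).
  - by apply: nearW => n; rewrite q0 andbT ltW//; case: (Hq n).
  - exact: cvg_cst.
  - by apply: cvg_expr; rewrite ger0_norm// invf_lt1// ltr1n.
have [f [fK fq]] := Cc_limit hX cK (fun n => (Hq n).1) qr r0.
have [C fC] := ess_bound_ex f.
have := archi_boundP (normr_ge0 C); set k := Num.bound _ => Ck.
have [_ _ _ _ /(_ f fK)] := HS k; apply; first by move=> x; exact: (fq k.+1).
by apply: ess_boundW fC; rewrite (le_trans (ler_norm _))// ltW.
Qed.

End uniform_bound.

(** * The system of dominated measures *)

Section cmeasure_topology.
Context (R : realType) (G : topologicalZmodType).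
Local Notation C := (R[i]^o).

Lemma cmeasure_ext (w w' : cmeasure R G) : w =1 w' -> w = w'.
Proof.
case: w w' => w cw [w' cw'] /= ww'.
have : w = w'.
  case: w w' cw cw' ww' => [w [[a] [b]]] [w' [[a'] [b']]] /= _ _ /funext ww'.
  by subst w'; congr (GRing.Linear.Pack (GRing.Linear.Class _ _)); 
    congr (_ _); exact: Prop_irrelevance.
by move=> e; subst w'; congr CMeasure; exact: Prop_irrelevance.
Qed.

Lemma cmeasure_cvg (I : Type) (F : set_system I) (g : I -> cmeasure R G)
    (w : cmeasure R G) : Filter F ->
  (forall f, (fun x => g x f : C) @ F --> (w f : C)) -> g @ F --> w.
Proof.
move=> FF gw; have H : {ptws, (fun x => g x : Cc R G -> C) @ F --> (w : Cc R G -> C)}.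
  by apply/pointwise_cvgP => f; exact: gw.
move=> A [B [[D oD <-] Dw] DA]; apply: filterS DA _ => /=.
by apply: (H D); exact: open_nbhs_nbhs.
Qed.

Lemma cmeasure_eval_continuous (f : Cc R G) :
  continuous (fun w : cmeasure R G => w f : C).
Proof.
move=> w; have c1 : continuous (fun nu : cmeasure R G => (nu : _ -> _) : {ptws Cc R G -> C}).
  exact: initial_continuous.
apply: (@continuous_comp _ {ptws Cc R G -> C} _
  (fun nu : cmeasure R G => (nu : _ -> _) : {ptws Cc R G -> C}) (fun h => h f)).
  exact: c1.
exact: (@proj_continuous (Cc R G) (fun=> C) f).
Qed.

Lemma set_type_cvg (X : topologicalType) (O : set X) (I : Type) (F : set_system I)
    (g : I -> O) (w : O) : Filter F ->
  (fun x => set_val (g x)) @ F --> (set_val w : X) -> g @ F --> w.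
Proof.
move=> FF gw A [B [[D oD <-] Dw] DA]; apply: filterS DA _ => /=.
by apply: (gw D); exact: open_nbhs_nbhs.
Qed.

Lemma cmeasure_subset_hausdorff (O : set (cmeasure R G)) : hausdorff_space O.
Proof.
move=> p q pq; apply: val_inj; apply: cmeasure_ext => f.
have hC : hausdorff_space C by exact: norm_hausdorff.
apply: hC => A B Ap Bq.
have ce : continuous (fun w : O => (set_val w : cmeasure R G) f : C).
  move=> w; have c1 : continuous (set_val : O -> cmeasure R G) by exact: initial_continuous.
  exact: (@continuous_comp O (cmeasure R G) C set_val (fun v => v f : C) w (c1 w)
    (@cmeasure_eval_continuous f _)).
by have [w [Aw Bw]] := pq _ _ (ce p A Ap) (ce q B Bq); exists ((set_val w : cmeasure R G) f).
Qed.

End cmeasure_topology.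

Section ultralimits.

Lemma ultra_map_filter (T U : Type) (f : T -> U) (F : set_system T) :
  UltraFilter F -> UltraFilter (f @ F).
Proof.
move=> uF; split; first exact: fmap_proper_filter.
move=> H pH FH; apply/seteqP; split=> A; last exact: FH.
move=> HA; have [//|nA] := in_ultra_setVsetC (f @^-1` A) uF.
by have [x []] := filter_ex (filterI HA (FH (~` A) nA)).
Qed.

Lemma ultra_cvg_bounded (R : realType) (T : Type) (F : set_system T) (h : T -> R) (M : R) :
  UltraFilter F -> (\forall x \near F, `|h x| <= M) -> exists l : R, h @ F --> l.
Proof.
move=> uF hM; have := @segment_compact R (- M) M; rewrite compact_ultra.
move=> /(_ (h @ F) (ultra_map_filter h uF)) [|l [_ hl]]; last by exists l.
by apply: filterS hM => x; rewrite /= in_itv/= ler_norml.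
Qed.

Lemma ultra_cvg_complex (R : realType) (T : Type) (F : set_system T) (h : T -> R[i]^o)
    (M : R) : UltraFilter F -> (\forall x \near F, `|h x| <= M%:C) ->
  exists l : R[i]^o, h @ F --> l.
Proof.
move=> uF hM.
have [|r hr] := @ultra_cvg_bounded _ _ F (fun x => complex.Re (h x)) M uF.
  by apply: filterS hM => x; rewrite -lecR; apply: le_trans; exact: normc_ge_Re.
have [|s hs] := @ultra_cvg_bounded _ _ F (fun x => complex.Im (h x)) M uF.
  by apply: filterS hM => x; rewrite -lecR; apply: le_trans; exact: normc_ge_Im.
exists (r +i* s).
rewrite (_ : h = (fun p : R * R => (p.1 +i* p.2) : R[i]^o) \o
    (fun n => (complex.Re (h n), complex.Im (h n)))); last first.
  by apply/funext => n /=; case: (h n).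
exact: cvg_comp (cvg_pair hr hs) (@continuous_complex R (r, s)).
Qed.

End ultralimits.

Section dominated.
Context (R : realType) (G : topologicalZmodType) (hG : hausdorff_space G).
Context d (T : measurableType d) (m : probability T R).
Context (L : {linear Cc R G -> L2 m}) (cL : continuous L).
Hypothesis bL : forall f, Linfty (L f).
Local Notation C := (R[i]^o).

Definition dominated : set (cmeasure R G) :=
  [set w | forall f (M : R), ess_bound L f M -> `|w f| <= M%:C].

(** [uniform_ess_bound] bounds [w] on every [CcK K], so the preimage of a disc is an absolutely
    convex neighbourhood of 0. *)
Lemma dominated_linear_continuous (w : {linear Cc R G -> C}) :
  (forall f (M : R), ess_bound L f M -> `|w f| <= M%:C) -> continuous w.
Proof.
move=> wM f V [e /= e0 eV].
have eE := Re_gt0K e0.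
have e0' : 0 < complex.Re e / 2 by rewrite divr_gt0// -ltcR eE.
exists [set g | `|w g| <= (complex.Re e / 2)%:C]; last first.
  move=> g wg; apply: eV; rewrite /ball_/= -normrN opprB -linearB.
  by apply: le_lt_trans wg _; rewrite -[ltRHS]eE ltcR; lra.
split=> [u v a b wu wv ab|K cK].
  rewrite /= linearD !linearZ /=; apply: (le_trans (ler_normD _ _)).
  have -> : `|a * w u| = `|a| * `|w u| by exact: normrM.
  have -> : `|b * w v| = `|b| * `|w v| by exact: normrM.
  apply: le_trans (lerD (ler_wpM2l (normr_ge0 a) wu) (ler_wpM2l (normr_ge0 b) wv)) _.
  by rewrite -mulrDl ler_piMl// ler0c ltW.
have [D D0 HD] := uniform_ess_bound hG cL bL cK.
exists (complex.Re e / 2 / D); first by rewrite divr_gt0.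
move=> g gK ge; apply: wM.
rewrite -[X in ess_bound _ _ X](mulfVK (lt0r_neq0 D0)) mulrC.
by apply: HD => //; rewrite divr_gt0.
Qed.

(** Linearity and domination are required only eventually, for each choice of arguments separately.
    This serves both the compactness of [dominated] and the values [L f x], which are linear in [f]
    only almost everywhere. *)
Lemma ultralimit (I : Type) (F : set_system I) (n : I -> Cc R G -> C) : UltraFilter F ->
  (forall f (M : R), ess_bound L f M -> \forall x \near F, `|n x f| <= M%:C) ->
  (forall a f g, \forall x \near F, n x (a *: f + g) = a * n x f + n x g) ->
  exists w : cmeasure R G, dominated w /\ forall f, n ^~ f @ F --> (w f : C).
Proof.
move=> uF nM nl.
have /choice[w nw] f : exists l : C, n ^~ f @ F --> l.
  by have [M fM] := ess_bound_ex bL f; exact: ultra_cvg_complex (nM f M fM).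
have wl : linear w.
  move=> a f g.
  have h : (fun x => a *: n x f + n x g) @ F --> (a *: w f + w g : C).
    by apply: (@cvgD _ C); [exact: cvg_comp (nw f) (@scaler_continuous _ C a (w f))|exact: nw].
  have e : (fun x => n x (a *: f + g)) @ F `=>` (fun x => a *: n x f + n x g : C) @ F.
    by apply: near_eq_cvg; apply: filterS (nl a f g) => x ->.
  have h2 : (fun x => n x (a *: f + g)) @ F --> (a *: w f + w g : C) by exact: cvg_trans e h.
  have hC : hausdorff_space C by exact: norm_hausdorff.
  exact: (cvg_unique hC (nw _) h2).
have wM f M : ess_bound L f M -> `|w f| <= M%:C.
  move=> fM; rewrite -Re_normc lecR.
  have h : (fun x => complex.Re `|n x f| : R) @ F --> (complex.Re `|w f| : R).
    exact: cvg_comp (nw f) (@continuous_modulus R (w f)).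
  apply: (cvgr_to_le h); apply: filterS (nM f M fM) => x.
  by rewrite -lecR Re_normc.
pose wL : {linear Cc R G -> C} := HB.pack w (GRing.isLinear.Build _ _ _ _ w wl).
by exists (CMeasure (@dominated_linear_continuous wL wM)).
Qed.

Lemma dominated_ultra (I : Type) (F : set_system I) (g : I -> cmeasure R G) :
  UltraFilter F -> F (g @^-1` dominated) -> exists w, dominated w /\ g @ F --> w.
Proof.
move=> uF FD; have [||w [Dw gw]] := @ultralimit _ F (fun x f => g x f) uF.
- by move=> f M fM; apply: filterS FD => x; exact.
- by move=> a f h; apply: nearW => x; rewrite linearP.
by exists w; split => //; exact: cmeasure_cvg.
Qed.

Lemma dominated_compact : compact dominated.
Proof.
rewrite compact_ultra => F uF FD.
have [w [Dw Fw]] := @dominated_ultra _ F id uF FD.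
by exists w; split.
Qed.

Lemma dominated_type_compact : compact [set: dominated].
Proof.
rewrite compact_ultra => F uF _.
have [w [Dw Fw]] : exists w, dominated w /\ (set_val : dominated -> cmeasure R G) @ F --> w.
  by apply: dominated_ultra; apply: filterE => x; exact: set_mem (valP x).
pose w' : dominated := SigSub (mem_set Dw).
by exists w'; split => //; exact: (@set_type_cvg _ dominated _ F id w').
Qed.

End dominated.

Section translates.
Context (R : realType) (G : topologicalZmodType).

(** For [t] in a compact neighbourhood [U] of [t0], all the translates live on the compact set [K],
    the sum of the support of [f] and [U]. A tube argument over [K] makes them uniformly close. *)
Lemma translate_near (f : Cc R G) (t0 : G) : locally_compact [set: G] ->
  exists2 K : set G, compact K & forall e : R, 0 < e -> \forall t \near t0,
    CcK K (translate t f - translate t0 f) /\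
    forall x, `|(translate t f - translate t0 f) x| <= e%:C.
Proof.
move=> lcG; have [cf kf] := CcP f.
have [U tU [cU _]] := lcG t0 I; rewrite withinE/= in tU.
have {}tU : nbhs t0 U.
  case: tU => V Vt UV; apply: filterS Vt => x Vx.
  by have : (V `&` setT) x by []; rewrite -UV => -[].
pose K := (fun p : G * G => p.1 + p.2) @` (tsupport f `*` U).
have cK : compact K.
  apply: continuous_compact; last exact: compact_setX.
  by apply: continuous_subspaceT; exact: add_continuous.
have tK t : U t -> CcK K (translate t f).
  move=> Ut x /tsupport_translate[y fy <-]; by exists (y, t).
exists K => // e e0.
have tK2 t : U t -> CcK K (translate t f - translate t0 f).
  move=> Ut; rewrite addrC -scaleN1r; apply: CcKD; last exact: tK.
  exact: tK (nbhs_singleton tU).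
have KP := (compact_near_coveringP K).1 cK G (nbhs t0)
  (fun t x => `|f (x - t) - f (x - t0)| <= e%:C) (nbhs_filter t0).
have unif : \forall t \near t0, K `<=` (fun x => `|f (x - t) - f (x - t0)| <= e%:C).
  apply: KP => x Kx.
  have sc : continuous (fun p : G * G => p.1 - p.2) by exact: sub_continuous.
  have fc1 : (fun p : G * G => f (p.1 - p.2)) @ (x, t0) --> f (x - t0).
    exact: cvg_comp (sc (x, t0)) (cf (x - t0)).
  have fc2 : (fun p : G * G => f (p.1 - t0)) @ (x, t0) --> f (x - t0).
    have c1 : (fun p : G * G => p.1 - t0) @ (x, t0) --> x - t0.
      exact: cvg_comp (@cvg_fst _ _ (nbhs x) (nbhs t0) _) (@subr_continuous G t0 x).
    exact: cvg_comp c1 (cf (x - t0)).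
  have e2 : 0 < (e / 2)%:C by rewrite ltcR divr_gt0.
  have /cvgrPdist_lt/(_ _ e2) h1 := fc1.
  have /cvgrPdist_lt/(_ _ e2) h2 := fc2.
  apply: filterS2 h1 h2 => -[y t] /= h1 h2.
  rewrite -(subrKA (f (x - t0))) (le_trans (ler_normD _ _))//.
  by rewrite distrC (splitr e) rmorphD lerD// ltW.
apply: filterS2 tU unif => t Ut Kt; split; first exact: tK2.
move=> x; have [Kx|nKx] := pselect (K x); first exact: Kt.
suff -> : (translate t f - translate t0 f) x = 0 by rewrite normr0 ler0c ltW.
apply/eqP; apply: contrapT => /negP fx; apply: nKx; apply: (tK2 t Ut).
exact: subset_closure.
Qed.

End translates.

Section process.
Context (R : realType) (G : topologicalZmodType) (hG : hausdorff_space G).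
Context (lcG : locally_compact [set: G]).
Context (S : dynamical_system G) (m : probability (ds_space S) R).
Context (N : spatial_process m).
Hypothesis bN : forall f : Cc R G, Linfty (N f).
Local Notation C := (R[i]^o).
Local Notation L := (sp_map N).
Local Notation O := (dominated L).

Lemma ae_act t (P : set (ds_space S)) :
  {ae m, forall x, P x} -> {ae m, forall x, P (@ds_act G S t x)}.
Proof.
move=> [A [mA A0 PA]]; exists (@ds_act G S t @^-1` A); split.
- by rewrite -[X in measurable X]setTI; exact: ds_act_measurable.
- exact: etrans (sp_invariant N t mA) A0.
- by move=> x nP; exact: PA.
Qed.

(** [N] turns translations into Koopman operators, which preserve essential bounds. Translation
    boundedness and invariance of [dominated] both follow. *)
Lemma ess_bound_translate t f (M : R) :
  ess_bound L f M -> ess_bound L (translate t f) M.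
Proof.
move=> /(ae_act (- t)) fM; rewrite /ess_bound -sp_koopman.
apply: filterS2 fM (koopmanE t (L f) (sp_invariant N)) => x fx e.
by rewrite /modulus e.
Qed.

Lemma dominated_TBMDS : is_TBMDS O.
Proof.
split.
- move=> w Ow f; have [M fM] := ess_bound_ex bN f.
  exists M%:C; split; first by rewrite realE !lecR -realE num_real.
  move=> r /ltW Mr t _ /=; apply: le_trans Mr.
  by apply: Ow; exact: ess_bound_translate.
- exact (dominated_compact hG (@sp_continuous _ _ _ _ N) bN).
- by move=> t w Ow f M fM; apply: Ow; exact: ess_bound_translate.
Qed.

Lemma translate0 (f : Cc R G) : translate 0 f = f.
Proof. by apply: Cc_ext => x /=; rewrite subr0. Qed.

Lemma translateD s t (f : Cc R G) : translate (s + t) f = translate s (translate t f).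
Proof. by apply: Cc_ext => x /=; rewrite opprD addrA. Qed.

Lemma dominated_system : topological_system (TBMDS_act dominated_TBMDS).
Proof.
split.
- exact (dominated_type_compact hG (@sp_continuous _ _ _ _ N) bN).
- exact: cmeasure_subset_hausdorff.
- split=> [w|s t w]; apply: val_inj => /=; apply: cmeasure_ext => f /=.
    by rewrite oppr0 translate0.
  by rewrite opprD addrC translateD.
- move=> [t0 w0]; apply: set_type_cvg; apply: cmeasure_cvg => f /=.
  (* Joint continuity: the change of [w] is controlled at the fixed function [translate (- t0) f],
     the change of [t] uniformly over all dominated [w] by the bound on [CcK K]. *)
  have [K cK HK] := translate_near f (- t0) lcG.
  have [D D0 HD] := uniform_ess_bound hG (@sp_continuous _ _ _ _ N) bN cK.
  apply/(@cvgrPdist_lt _ C) => e e0.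
  have eE := Re_gt0K e0.
  have e0' : 0 < complex.Re e / 2 by rewrite divr_gt0// -ltcR eE.
  have e1 : 0 < complex.Re e / 2 / D by rewrite divr_gt0.
  have H1 := @opp_continuous G t0 _ (HK _ e1).
  have e2 : 0 < (complex.Re e / 2)%:C by rewrite ltcR.
  have c1 : continuous (set_val : O -> cmeasure R G) by exact: initial_continuous.
  have /cvgrPdist_lt/(_ _ e2) H2 := @continuous_comp O (cmeasure R G) C set_val
    (fun v => v (translate (- t0) f) : C) w0 (c1 w0) (@cmeasure_eval_continuous R G _ _).
  exists ([set t | (CcK K `&` [set g | forall x, `|g x| <= (complex.Re e / 2 / D)%:C])
       (translate (- t) f - translate (- t0) f)],
    [set w : O | `|set_val w0 (translate (- t0) f) - set_val w (translate (- t0) f)|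
       < (complex.Re e / 2)%:C]).
    by split.
  move=> [t w] /= [[tK te] wt].
  rewrite -(subrKA (set_val w (translate (- t0) f))) (le_lt_trans (ler_normD _ _))//.
  rewrite -eE (splitr (complex.Re e)) rmorphD /= ltr_leD// distrC -linearB.
  rewrite -[X in X%:C](mulfVK (lt0r_neq0 D0)) mulrC.
  apply: (set_mem (valP w)).
  by apply: HD.
Qed.

End process.

(** * The spatial isomorphism *)

Section limit_map.
Context (R : realType) (G : topologicalZmodType) (hG : hausdorff_space G).
Context d (T : measurableType d) (m : probability T R).
Context (L : {linear Cc R G -> L2 m}) (cL : continuous L).
Hypothesis bL : forall f, Linfty (L f).
Local Notation C := (R[i]^o).
Local Notation O := (dominated L).

Lemma limit_point_ex U : conull_ultra m U ->
  exists w : O, forall f, L2_fun (L f) @ U --> ((set_val w : cmeasure R G) f : C).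
Proof.
move=> [uU cU].
have [||w [Dw Lw]] := @ultralimit _ _ hG _ _ _ _ cL bL _ U (fun x f => L2_fun (L f) x) uU.
- move=> f M fM; apply: filterS (cU _ fM) => x /=.
  by rewrite -lecR modulusE.
- move=> a f g; rewrite linearP.
  apply: filterS2 (cU _ (L2_addE (a *: L f) (L g))) (cU _ (L2_zmulE a (L f))) => x.
  by move=> /= -> ->.
by exists (SigSub (mem_set Dw)).
Qed.

Lemma limit_map_ex : exists pi : ultra_map m O,
  forall U, conull_ultra m U ->
    forall f, L2_fun (L f) @ U --> ((set_val (pi U) : cmeasure R G) f : C).
Proof.
have [U0 [cU0 _]] : exists U, conull_ultra m U /\ U setT.
  by apply: conull_ultra_ex => //; rewrite probability_setT.
have [w0 _] := limit_point_ex cU0.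
(* An [ultra_map] is total; [w0] is the value off the conull ultrafilters. *)
have /choice[p pP] : forall U, exists w : O, conull_ultra m U ->
    forall f, L2_fun (L f) @ U --> ((set_val w : cmeasure R G) f : C).
  move=> U; have [cU|ncU] := pselect (conull_ultra m U); last by exists w0.
  by have [w wU] := limit_point_ex cU; exists w.
suff pc U V : conull_ultra m U -> nbhs (p U) V -> exists A, [/\ measurable A, U A &
    forall W, conull_ultra m W -> W A -> V (p W)] by exists (UltraMap pc).
move=> cU; have [uU aeU] := cU.
(* [H] is the neighbourhood filter of [U] in the Stone space, generated by clopen sets. *)
pose H : set_system (set_system T) := [set P | exists A, [/\ measurable A, U A &
  forall W, conull_ultra m W -> W A -> P W]].
have FH : Filter H.
  split.
  - by exists setT; split => //; exact: filterT.
  - move=> P Q [A [mA UA AP]] [B [mB UB BQ]]; exists (A `&` B); split.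
    + exact: measurableI.
    + exact: filterI.
    + move=> W cW WAB; have [uW _] := cW; split.
        by apply: AP => //; apply: filterS WAB => x [].
      by apply: BQ => //; apply: filterS WAB => x [].
  - by move=> P Q PQ [A [mA UA AP]]; exists A; split => // W cW WA; apply/PQ/AP.
suff pH : p @ H --> p U by move=> /pH.
apply: set_type_cvg; apply: cmeasure_cvg => f.
apply/(@cvgrPdist_le _ C) => e e0.
have eE := Re_gt0K e0.
set l := set_val (p U) f.
have ml : complex_measurable (fun x => L2_fun (L f) x - l : C).
  by apply: complex_measurable_sub; [exact: L2_complex_measurable|split; exact: measurable_cst].
(* [U] contains this set because [L f] tends to [l] along [U]; the non-strict inequality passes to
   the limit along every other [W] that contains it. *)
exists [set x | (modulus (fun x => L2_fun (L f) x - l : C) x <= complex.Re e)%R]; split.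
- exact: measurable_set_le (measurable_modulus ml) _.
- have /(@cvgrPdist_le _ C)/(_ _ e0) := pP U cU f.
  apply: filterS => x /=; rewrite -/l -lecR modulusE eE.
  by rewrite distrC.
- move=> W cW WA; have [uW _] := cW.
  have h : (fun x => complex.Re `|L2_fun (L f) x - l| : R) @ W -->
      (complex.Re `|set_val (p W) f - l| : R).
    apply: (@cvg_comp _ _ _ (fun x => L2_fun (L f) x - l : C)
      (fun z : C => complex.Re `|z| : R) _ (nbhs (set_val (p W) f - l : C))).
      by apply: (@cvgB _ C); [exact: pP|exact: cvg_cst].
    exact: continuous_modulus.
  rewrite distrC -eE -Re_normc lecR; apply: (cvgr_to_le h).
  exact: WA.
Qed.

End limit_map.

Section act.
Context (R : realType) (G : topologicalZmodType).
Context (S : dynamical_system G) (m : probability (ds_space S) R).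
Hypothesis im : invariant_measure m.

Lemma conull_ultra_act t U : conull_ultra m U -> conull_ultra m (@ds_act G S t @ U).
Proof.
move=> [uU cU]; split; first exact: ultra_map_filter.
move=> P mP; apply: cU; case: mP => [A [mA A0 PA]].
exists (@ds_act G S t @^-1` A); split.
- by rewrite -[X in measurable X]setTI; exact: ds_act_measurable.
- exact: etrans (im t mA) A0.
- by move=> x nP; exact: PA.
Qed.

Lemma most_act t (P : set (set_system (ds_space S))) :
  most m P -> most m [set U | P (@ds_act G S t @ U)].
Proof.
move=> mP e e0; have [A [mA Ae] AP] := mP e e0.
exists (@ds_act G S t @^-1` A); last first.
  by move=> U cU UA; apply: AP => //; exact: conull_ultra_act.
split; first by rewrite -[X in measurable X]setTI; exact: ds_act_measurable.
by apply: le_lt_trans Ae; rewrite preimage_setC im//; exact: measurableC.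
Qed.

End act.

Lemma continuous_borel_measurable (R : realType) (Y : topologicalType) (y0 : Y)
    (h : Y -> R) : continuous h -> measurable_fun [set: borel y0] (h : borel y0 -> R).
Proof.
move=> ch; apply: (measurability _ (RGenOInfty.measurableE R)) => //.
move=> _ [_ [x ->] <-]; rewrite setTI.
apply: sub_sigma_algebra.
by move/continuousP : ch; apply; exact: interval_open.
Qed.

Lemma continuous_complex_measurable (R : realType) (Y : topologicalType) (y0 : Y)
    (h : Y -> R[i]^o) : continuous h -> complex_measurable (h : borel y0 -> R[i]^o).
Proof.
move=> ch; split; apply: continuous_borel_measurable => y.
- exact: cvg_comp (ch y) (@continuous_Re R (h y)).
- exact: cvg_comp (ch y) (@continuous_Im R (h y)).
Qed.

Lemma isometry_continuous (K : numFieldType) (X : topologicalType)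
    (V W : normedModType K) (h : X -> V) (U : {linear V -> W}) :
  (forall v, `|U v| = `|v|) -> continuous h -> continuous (fun x => U (h x)).
Proof.
move=> iU ch x; apply/cvgrPdist_lt => e e0.
have /cvgrPdist_lt/(_ _ e0) := ch x.
by apply: filterS => y; rewrite -linearB iU.
Qed.

(** * Equivariance of the limit map and the isomorphism of processes *)

Section representation.
Context (R : realType) (G : topologicalZmodType) (hG : hausdorff_space G).
Context (lcG : locally_compact [set: G]).
Context (S : dynamical_system G) (m : probability (ds_space S) R).
Context (N : spatial_process m).
Hypothesis bN : forall f : Cc R G, Linfty (N f).
Local Notation C := (R[i]^o).
Local Notation L := (sp_map N).
Local Notation O := (dominated L).
Context (pi : ultra_map m O) (w0 : O).
Hypothesis piP : forall U, conull_ultra m U ->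
  forall f, L2_fun (L f) @ U --> ((set_val (pi U) : cmeasure R G) f : C).
Local Notation TO := (dominated_TBMDS hG bN).
Local Notation S' := (TopologicalDS w0 (dominated_system hG lcG bN)).
Local Notation mu := (@push_measure _ (ds_space S) R m O w0 pi : probability (borel w0) R).
Local Notation evalO f := (fun w : O => (set_val w : cmeasure R G) f : C).
Local Notation matches u v := (matches pi (u : ds_space S -> C) (v : borel w0 -> C)).

Lemma evalO_continuous f : continuous (evalO f).
Proof.
move=> w; have c1 : continuous (set_val : O -> cmeasure R G) by exact: initial_continuous.
exact: (@continuous_comp O (cmeasure R G) C set_val (fun v => v f : C) w (c1 w)
    (@cmeasure_eval_continuous R G f _)).
Qed.

Lemma matches_eval f : matches (L f : L2 m) (evalO f).
Proof. by apply: most_all => U cU; exact: piP. Qed.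

(** [L f] composed with the action of [t] is almost everywhere [L (translate (- t) f)], whose limit
    along [U] is the value at [f] of the translated measure. *)
Lemma limit_map_act t U : conull_ultra m U ->
  pi (@ds_act G S t @ U) = TBMDS_act TO t (pi U).
Proof.
move=> cU; apply: val_inj; apply: cmeasure_ext => f.
have [uU aeU] := cU.
have h1 := @piP _ (conull_ultra_act (sp_invariant N) t cU) f.
have h2 := @piP _ cU (translate (- t) f).
have e : (fun x => L2_fun (L f) (@ds_act G S t x)) @ U `=>` L2_fun (L (translate (- t) f)) @ U.
  apply: near_eq_cvg; rewrite -sp_koopman.
  apply: filterS (aeU _ (koopmanE (- t) (L f) (sp_invariant N))) => x /= ->.
  by rewrite opprK.
have hC : hausdorff_space C by exact: norm_hausdorff.
exact: (cvg_unique hC h1 (cvg_trans e h2)).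
Qed.

Lemma push_invariant : @invariant_measure G R S' mu.
Proof.
move=> t B mB; have [E cE] := corr_borel pi mB.
have cE' : corr pi (@ds_act G S t @^-1` E) (TBMDS_act TO t @^-1` B).
  case: (cE) => mE cE'; split.
    by rewrite -[X in measurable X]setTI; exact: ds_act_measurable.
  apply: mostS (most_act (sp_invariant N) t cE') => U cU /=.
  by rewrite limit_map_act.
have h1 := push_measureE (y0 := w0) cE'.
have h2 := push_measureE (y0 := w0) cE.
apply: (etrans h1); rewrite [RHS]h2; apply: (sp_invariant N).
by case: cE.
Qed.

Lemma matches_act t (f : ds_space S -> C) (F : borel w0 -> C) : matches f F ->
  matches (fun x => f (@ds_act G S t x)) (fun w => F (TBMDS_act TO t w)).
Proof.
move=> fF; have mfF : most m [set U | f @ U --> F (pi U)] := fF.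
apply: mostS (most_act (sp_invariant N) t mfF) => U cU /=.
by rewrite limit_map_act.
Qed.

Lemma matches_koopman t (u : L2 m) (v : L2 mu) : matches u v ->
  matches (koopman t u) (koopman (S := S') t v).
Proof.
move=> uv; have h := matches_act (- t) uv.
have hl : matches (koopman t u) (fun w => v (TBMDS_act TO (- t) w)).
  by apply: matches_ae h; apply: filterS (koopmanE t u (sp_invariant N)) => x ->.
apply: matches_ae_push hl.
by apply: filterS (@koopmanE R G S' mu t v push_invariant) => x ->.
Qed.

Lemma matches_L2_conj (u : L2 m) (v : L2 mu) : matches u v ->
  matches (L2_conj u) (L2_conj v).
Proof.
move=> uv; have h := matches_conj uv.
have hl : matches (L2_conj u) (fun w => (v w)^*).
  by apply: matches_ae h; apply: filterS (L2_conjE u) => x ->.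
by apply: matches_ae_push hl; apply: filterS (L2_conjE v) => x ->.
Qed.

Lemma matches_prod (s : seq (Cc R R[i]^o * Cc R G)) :
  matches (fun x => \prod_(p <- s) p.1 (L2_fun (N p.2) x) : C)
    (fun w => \prod_(p <- s) p.1 (evalO p.2 w) : C) /\
  @complex_measurable _ (borel w0) R (fun w => \prod_(p <- s) p.1 (evalO p.2 w)).
Proof.
elim: s => [|[c f] s [IH mIH]].
  rewrite (_ : (fun x => _) = cst 1); last by apply/funext => x; rewrite big_nil.
  rewrite (_ : (fun w => _) = cst 1); last by apply/funext => x; rewrite big_nil.
  by split; [exact: matches_cst|split; exact: measurable_cst].
rewrite (_ : (fun x => _) = (fun x => c (L2_fun (N f) x) *
    \prod_(p <- s) p.1 (L2_fun (N p.2) x))); last first.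
  by apply/funext => x; rewrite big_cons.
rewrite (_ : (fun w => _) = (fun w => c (evalO f w) *
    \prod_(p <- s) p.1 (evalO p.2 w))); last first.
  by apply/funext => x; rewrite big_cons.
have [cc _] := CcP c; split.
  apply: matches_mul IH.
  exact: matches_comp (fun y => cc (evalO f y)) (matches_eval f).
apply: complex_measurable_mul mIH.
apply: (@continuous_complex_measurable R O w0 (fun w => c (evalO f w))) => w.
exact: cvg_comp (@evalO_continuous f w) (cc _).
Qed.

Lemma matches_span (u : L2 m) : linear_span (process_products N) u ->
  exists v : L2 mu, matches u v.
Proof.
move=> [n [c [a [Ha ->]]]]; elim/big_ind: _ => [|u1 u2 [v1 h1] [v2 h2]|i _].
- by exists 0; exact: L2_zero_matches.
- by exists (v1 + v2 : L2 mu); exact (L2_add_matches h1 h2).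
- have [s hs] := Ha i; have [ms mm] := matches_prod s.
  have h : matches (a i : L2 m) (fun w => \prod_(p <- s) p.1 (evalO p.2 w) : C).
    by apply: matches_ae ms; apply: filterS hs => x ->.
  have [v [hv _]] := L2_push mm h.
  by exists (c i *: v : L2 mu); exact (L2_scale_matches (c i) hv).
Qed.

(** Both [v] and the evaluation at [f] match [L f], so their difference matches 0. *)
Lemma eval_uniq f (v : L2 mu) : matches (L f : L2 m) v ->
  {ae mu, forall w, v w = evalO f w}.
Proof.
move=> fv; have h := matches_sub fv (matches_eval f).
have h0 : matches (cst 0) (fun w => v w - evalO f w).
  by apply: matches_ae h; apply: nearW => x; rewrite subrr.
have mE : @complex_measurable _ (borel w0) R (fun w => v w - evalO f w).
  apply: complex_measurable_sub; first exact: L2_complex_measurable.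
  exact: (@continuous_complex_measurable R O w0 (evalO f) (@evalO_continuous f)).
by apply: filterS (matches_0eq mE h0) => w /eqP; rewrite subr_eq0 => /eqP.
Qed.

Context (U : {linear L2 m -> L2 mu}) (V : L2 mu -> L2 m).
Hypotheses (UV : cancel U V) (VU : cancel V U).
Hypothesis mU : forall u : L2 m, matches u (U u : L2 mu).

Lemma unitary_matches_V (v : L2 mu) : matches (V v) v.
Proof. by rewrite -{2}(VU v); exact: mU. Qed.

Lemma unitary_continuous : continuous (fun f => U (L f)).
Proof.
apply: (@isometry_continuous R[i] (Cc R G) (L2 m) (L2 mu) L U).
  by move=> v; rewrite (L2_norm_matches (mU v)).
exact: (@sp_continuous _ _ _ _ N).
Qed.

Lemma unitary_conj f : L2_conj (U (L f) : L2 mu) = U (L (Cc_conj f)).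
Proof.
rewrite -sp_conj; apply: L2_matches_inj (mU _).
exact/matches_L2_conj/mU.
Qed.

Lemma unitary_koopman t (u : L2 m) : U (koopman t u) = koopman (S := S') t (U u : L2 mu).
Proof. by apply: L2_matches_inj (mU _) _; exact/matches_koopman/mU. Qed.

(** Matching respects products of functions, whether or not these are square-integrable;
    [U w - U u * U v] matches [w - u * v], which vanishes almost everywhere. *)
Lemma unitary_mul : multiplicative_Linfty U.
Proof.
move=> u v w _ _ wuv.
have h := matches_sub (mU w) (matches_mul (mU u) (mU v)).
have h0 : matches (cst 0) (fun y => (U w : L2 mu) y - (U u : L2 mu) y * (U v : L2 mu) y).
  by apply: matches_ae h; apply: filterS wuv => x ->; rewrite subrr.
have mE : @complex_measurable _ (borel w0) R
    (fun y => (U w : L2 mu) y - (U u : L2 mu) y * (U v : L2 mu) y).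
  by apply: complex_measurable_sub; [|apply: complex_measurable_mul]; exact: L2_complex_measurable.
by apply: filterS (matches_0eq mE h0) => y /eqP; rewrite subr_eq0 => /eqP.
Qed.

Lemma unitary_mulV : multiplicative_Linfty V.
Proof.
move=> u v w _ _ wuv.
have h := matches_sub (unitary_matches_V w)
  (matches_mul (unitary_matches_V u) (unitary_matches_V v)).
have h0 : matches (fun x => V w x - V u x * V v x) (cst 0).
  by apply: matches_ae_push h; apply: filterS wuv => x ->; rewrite subrr.
have mE : complex_measurable (fun x => V w x - V u x * V v x : C).
  by apply: complex_measurable_sub; [|apply: complex_measurable_mul]; exact: L2_complex_measurable.
by apply: filterS (@matches_eq0 _ _ R m O w0 pi _ mE h0) => y /eqP; rewrite subr_eq0 => /eqP.
Qed.

Lemma unitary_equivalent : exists N' : @spatial_process R G S' mu,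
  (forall f, {ae mu, forall w, (N' f : L2 mu) w = evalO f w}) /\
  equivalent_processes N N'.
Proof.
(* Defined as [U] after [N], the new process is intertwined with [N] by construction; [eval_uniq]
   identifies it with evaluation. *)
pose N0 : {linear Cc R G -> L2 mu} := HB.pack (fun f => U (L f))
  (GRing.isLinear.Build _ _ _ _ (fun f => U (L f)) (linearP (U \o L))).
have kN t f : koopman (S := S') t (N0 f) = N0 (translate t f).
  by rewrite /= -unitary_koopman sp_koopman.
pose N' : @spatial_process R G S' mu := @SpatialProcess R G S' mu N0 push_invariant
  unitary_continuous unitary_conj kN.
exists N'; split; first by move=> f; exact: eval_uniq (mU _).
exists U, V; split => //.
- by move=> u v; rewrite (L2_dot_matches (mU u) (mU v)).
- exact: unitary_koopman.
- exact: unitary_mul.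
- exact: unitary_mulV.
Qed.

End representation.

Theorem theorem3p1 (R : realType) (G : topologicalZmodType)
    (hausdorffG : hausdorff_space G)
    (locally_compactG : locally_compact [set: G])
    (sigma_compactG : sigma_compact [set: G])
    (S : dynamical_system G) (m : probability (ds_space S) R)
    (N : spatial_process m)
    (fullN : full_process N)
    (boundedN : forall f : Cc R G, Linfty (N f)) :
  exists (O : set (cmeasure R G)) (TO : is_TBMDS O)
    (TopO : topological_system (TBMDS_act TO)) (w0 : O)
    (m' : probability (ds_space (TopologicalDS w0 TopO)) R)
    (N' : spatial_process m'),
    (forall f : Cc R G,
      {ae m', forall w : O, L2_fun (N' f) w = (set_val w : cmeasure R G) f}) /\
    equivalent_processes N N'.
Proof.
have [pi piP] := limit_map_ex hausdorffG (@sp_continuous _ _ _ _ N) boundedN.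
(* Any element of the system may be the distinguished point of the Borel space. *)
pose w0 := pi setT.
(* Fullness enters here: the functions known to have partners span a dense subspace. *)
have ex_v := L2_matches_dense fullN (@matches_span _ _ _ _ _ pi w0 piP).
have [U [V [UV VU mU _]]] := unitary_ex ex_v.
have [N' HN'] := unitary_equivalent hausdorffG locally_compactG boundedN piP UV VU mU.
exists (dominated (sp_map N)), (dominated_TBMDS hausdorffG boundedN).
exists (dominated_system hausdorffG locally_compactG boundedN), w0.
by exists (push_measure pi : probability _ R), N'.
Qed.
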